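(* Let $r\ge2$ be an integer, $K$ a triangle and $i\in\{1,2,3\}$. The space $Q_i^{r-2}(K)$ takes the form \[ Q_i^{r-2}(K)=\operatorname{span}\bigl\{P_{k,r-2}^{(1,2,2)}(\lambda_i,\lambda_i^+,\lambda_i^-)\ :\ 0\le k\le r-2\bigr\}. \]
   Context: $K$ is a triangle with barycentric coordinates $\lambda_1,\lambda_2,\lambda_3$ and edges $e_1,e_2,e_3$ with $\lambda_i\equiv0$ on $e_i$. For each $i$, $\lambda_i^+$ and $\lambda_i^-$ are the two other barycentric coordinates, associated with the edges $e_i^+$ and $e_i^-$ (on which they vanish, respectively), where $(e_i,e_i^+,e_i^-)$ are ordered counterclockwise. $b_K=\lambda_1\lambda_2\lambda_3$, $b_i=b_K/\lambda_i$. With $\mathbb P_m=\{0\}$ for $m<0$, \[ Q_i^{r-2}(K)=\Bigl\{v\in\mathbb P_{r-2}(K):\int_K b_Kb_i v q\,d\boldsymbol x=0\ \text{for all }q\in\mathbb P_{r-3}(K)\Bigr\}. \] $P_n^{(\alpha,\beta)}$ ($\alpha,\beta>-1$) is the Jacobi polynomial given by \[ (1-t)^\alpha(1+t)^\beta P_n^{(\alpha,\beta)}(t)=\frac{(-1)^n}{2^nn!}\frac{d^n}{dt^n}\bigl((1-t)^{n+\alpha}(1+t)^{n+\beta}\bigr), \] and for integers $0\le k\le n$ and $\alpha,\beta,\gamma>-1$, on $\lambda_1+\lambda_2+\lambda_3=1$, \[ P_{k,n}^{(\alpha,\beta,\gamma)}(\lambda_1,\lambda_2,\lambda_3)=(\lambda_2+\lambda_3)^kP_{n-k}^{(2k+\beta+\gamma+1,\alpha)}(\lambda_1-\lambda_2-\lambda_3)\,P_k^{(\gamma,\beta)}\Bigl(\frac{\lambda_2-\lambda_3}{\lambda_2+\lambda_3}\Bigr),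 \] which is a polynomial in $\mathbb P_n(K)$. *)

(* Defs.v *)
From HB Require Import structures.
From mathcomp Require Import all_boot all_order all_algebra.
From mathcomp Require Import ring lra.
From mathcomp Require Import all_classical all_reals all_analysis.
(* The notations of mpoly clash with those of the analysis library. *)
From mathcomp Require mpoly.
Import (canonicals, coercions) mpoly.
Set Implicit Arguments.
Unset Strict Implicit.
Unset Printing Implicit Defensive.
Import Order.TTheory GRing.Theory Num.Theory.
Import numFieldNormedType.Exports.

Local Open Scope classical_set_scope.
Local Open Scope ring_scope.

Section Span.
Variables (R : pzRingType) (V : lmodType R).

Definition lin_span (S : set V) : set V :=
  [set v | exists (n : nat) (c : 'I_n -> R) (f : 'I_n -> V),
     (forall j, S (f j)) /\ v = \sum_(j < n) c j *: f j].

End Span.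

Section Jacobi.
Variable R : realType.
Implicit Types (a b c t : R) (p q : {poly R}).

(* Rodrigues' formula, imposed on the open interval where the weight does not
   vanish and the real powers are smooth. *)
Definition rodrigues a b (n : nat) p : Prop :=
  forall t, -1 < t < 1 ->
    (1 - t) `^ a * (1 + t) `^ b * p.[t] =
    (-1) ^+ n / (2 ^+ n * n`!%:R) *
    derive1n n (fun s : R => (1 - s) `^ (n%:R + a) * (1 + s) `^ (n%:R + b)) t.

(* The Jacobi polynomial P_n^(a, b): the only polynomial satisfying Rodrigues'
   formula, by rodrigues_exists and rodrigues_uniq below. *)
Definition jacobi a b (n : nat) : {poly R} := xget 0 (rodrigues a b n).

Lemma derive1n_weight a b (n : nat) : exists q, forall t, -1 < t < 1 ->
  derive1n n (fun s : R => (1 - s) `^ a * (1 + s) `^ b) t =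
  (1 - t) `^ (a - n%:R) * (1 + t) `^ (b - n%:R) * q.[t].
Proof.
elim: n => [|n [q IH]].
  by exists 1 => t _; rewrite derive1n0 hornerC !subr0 mulr1.
set a' := a - n%:R; set b' := b - n%:R.
exists (- a' *: ((1 + 'X) * q) + b' *: ((1 - 'X) * q)
        + (1 - 'X) * (1 + 'X) * q^`()) => t /andP[t1 t2].
rewrite derive1nS derive1E.
have p1 : 0 < 1 - t by lra.
have p2 : 0 < 1 + t by lra.
pose g (s : R) := (1 - s) `^ a' * (1 + s) `^ b' * q.[s].
rewrite (near_eq_derive _ (g := g)); last first.
  have tI : t \in `]-1, 1[ by rewrite in_itv/= t1 t2.
  by apply: filterS (near_in_itvoo tI) => s; rewrite in_itv; exact: IH.
have d1 : is_derive t 1 (fun s : R => (1 - s) `^ a')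
    (a' * (1 - t) `^ (a' - 1) * -1).
  apply: (@is_derive1_comp _ (fun x => x `^ a') (fun s => 1 - s)).
    exact: is_derive1_powR.
  rewrite -[-1]sub0r.
  exact: (is_deriveB (is_derive_cst _ _ _) (is_derive_id _ _)).
have d2 : is_derive t 1 (fun s : R => (1 + s) `^ b')
    (b' * (1 + t) `^ (b' - 1) * 1).
  apply: (@is_derive1_comp _ (fun x => x `^ b') (fun s => 1 + s)).
    exact: is_derive1_powR.
  rewrite -[X in is_derive _ _ _ X]add0r.
  exact: (is_deriveD (is_derive_cst _ _ _) (is_derive_id _ _)).
have -> : 'D_1 g t = (1 - t) `^ a' * (1 + t) `^ b' * q^`().[t] + q.[t] *
   ((1 - t) `^ a' * (b' * (1 + t) `^ (b' - 1) * 1)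
    + (1 + t) `^ b' * (a' * (1 - t) `^ (a' - 1) * -1)).
  have dg : is_derive t 1 g ((1 - t) `^ a' * (1 + t) `^ b' * q^`().[t] + q.[t] *
   ((1 - t) `^ a' * (b' * (1 + t) `^ (b' - 1) * 1)
    + (1 + t) `^ b' * (a' * (1 - t) `^ (a' - 1) * -1))).
    exact: (is_deriveM (is_deriveM d1 d2) (is_derive_poly q t)).
  by rewrite derive_val.
have -> : a - n.+1%:R = a' - 1 by rewrite /a' -natr1 opprD addrA.
have -> : b - n.+1%:R = b' - 1 by rewrite /b' -natr1 opprD addrA.
have e (x c : R) : 0 < x -> x `^ c = x * x `^ (c - 1).
  move=> x0; have xN0 : x != 0 by rewrite gt_eqF.
  have := @powRD _ x 1 (c - 1); rewrite xN0 implybT powRr1 ?ltW// => <- //.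
  by rewrite addrC subrK.
have e1 : (1 - t) `^ a' = (1 - t) * (1 - t) `^ (a' - 1) by exact: e.
have e2 : (1 + t) `^ b' = (1 + t) * (1 + t) `^ (b' - 1) by exact: e.
rewrite e1 e2 -polyC1.
by rewrite !(hornerD, hornerM, hornerZ, hornerN, hornerX, hornerC); ring.
Qed.

Lemma rodrigues_exists a b (n : nat) : exists p, rodrigues a b n p.
Proof.
have [q Hq] := derive1n_weight (n%:R + a) (n%:R + b) n.
exists ((-1) ^+ n / (2 ^+ n * n`!%:R) *: q) => t tI.
by rewrite Hq// ![n%:R + _]addrC !addrK hornerZ mulrCA.
Qed.

Lemma rodrigues_uniq a b (n : nat) p q :
  rodrigues a b n p -> rodrigues a b n q -> p = q.
Proof.
move=> Hp Hq; apply/eqP; rewrite -subr_eq0; apply/negPn/negP => d0.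
pose s := [seq (j.+2%:R : R)^-1 | j <- iota 0 (size (p - q)%R)].
have us : uniq s.
  rewrite map_inj_uniq ?iota_uniq// => i j /invr_inj /eqP.
  by rewrite eqr_nat => /eqP[].
suff rs : all (root (p - q)) s.
  by have := max_poly_roots d0 rs us; rewrite size_map size_iota ltnn.
apply/allP => _ /mapP[j _ ->]; rewrite rootE hornerD hornerN subr_eq0.
set t := _^-1.
have t0 : 0 < t by rewrite invr_gt0 ltr0n.
have t1 : t < 1 by rewrite invf_lt1 ?ltr0n// ltr1n.
have tI : -1 < t < 1 by apply/andP; split=> //; lra.
have w0 : (1 - t) `^ a * (1 + t) `^ b != 0.
  by rewrite mulf_neq0// gt_eqF// powR_gt0//; lra.
by apply/eqP/(mulfI w0); rewrite (Hp _ tI) (Hq _ tI).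
Qed.

Lemma jacobiP a b (n : nat) : rodrigues a b n (jacobi a b n).
Proof. exact: (xgetPex 0 (rodrigues_exists a b n)). Qed.

(* On l1 + l2 + l3 = 1, l2 + l3 vanishes at a point of a triangle only when
   l2 = l3 = 0; there x / 0 = 0 gives k = 0 the factor 1 and k > 0 the factor
   0, which are the values of the homogenized polynomial. *)
Definition tri_jacobi a b c (k n : nat) (l1 l2 l3 : R) : R :=
  (l2 + l3) ^+ k * (jacobi (k%:R *+ 2 + b + c + 1) a (n - k)).[l1 - l2 - l3]
  * (jacobi c b k).[(l2 - l3) / (l2 + l3)].

End Jacobi.

Section Triangle.
Variable R : realType.

(* Twice the signed area of xyz: positive iff x, y, z are counterclockwise. *)
Definition orient (x y z : R * R) : R :=
  (y.1 - x.1) * (z.2 - x.2) - (z.1 - x.1) * (y.2 - x.2).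

(* The edge e_i is the one opposite to the vertex of index i. No orientation is
   imposed on the numbering of the vertices. Indices in 'I_3 are added mod 3. *)
Record triangle := Triangle {
  vertex : 'I_3 -> R * R;
  vertex_noncollinear : orient (vertex 0) (vertex 1) (vertex 2) != 0 }.

Implicit Types (T : triangle) (i : 'I_3) (m : int).

Definition tri T : set (R * R) :=
  [set x | exists c : 'I_3 -> R,
     [/\ forall j, 0 <= c j, \sum_j c j = 1,
         x.1 = \sum_j c j * (vertex T j).1 &
         x.2 = \sum_j c j * (vertex T j).2]].

Definition bary T i (x : R * R) : R :=
  orient x (vertex T (i + 1)) (vertex T (i + 2)) /
  orient (vertex T i) (vertex T (i + 1)) (vertex T (i + 2)).

Lemma ord3P i : [\/ i = 0, i = 1 | i = 2].
Proof.
case: i => [[|[|[|//]]] h]; [apply: Or31|apply: Or32|apply: Or33];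
  exact/val_inj.
Qed.

Lemma ord3D : ((1 + 1 = 2 :> 'I_3)%R * (1 + 2 = 0 :> 'I_3)%R *
  (2 + 1 = 0 :> 'I_3)%R * (2 + 2 = 1 :> 'I_3)%R)%type.
Proof. by do !split; apply/val_inj. Qed.

Lemma sum_ord3 (F : 'I_3 -> R) : \sum_j F j = F 0 + F 1 + F 2.
Proof.
rewrite !big_ord_recl big_ord0 addr0 addrA.
by congr (_ + F _ + F _); apply/val_inj.
Qed.

Lemma baryE T i x : bary T i x =
  orient x (vertex T (i + 1)) (vertex T (i + 2)) /
  orient (vertex T 0) (vertex T 1) (vertex T 2).
Proof.
rewrite /bary; congr (_ / _).
by case: (ord3P i) => ->; rewrite ?add0r ?ord3D // /orient; ring.
Qed.

Lemma sum_bary T x : \sum_i bary T i x = 1.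
Proof.
have := vertex_noncollinear T.
rewrite sum_ord3 !baryE !add0r !ord3D => h.
by rewrite -!mulrDl; apply: canLR (mulfK h) _; rewrite mul1r /orient; ring.
Qed.

Lemma bary_vertex T i j : bary T i (vertex T j) = (i == j)%:R.
Proof.
have h := vertex_noncollinear T.
rewrite baryE; apply: canLR (mulfK h) _.
by case: (ord3P i) => ->; case: (ord3P j) => ->;
  rewrite ?add0r ?ord3D /= ?mul1r ?mul0r /orient; ring.
Qed.

(* Opposite edges are ordered counterclockwise iff the vertices are. *)
Definition ccw T : bool := 0 < orient (vertex T 0) (vertex T 1) (vertex T 2).

(* (e_i, e_(iplus T i), e_(iminus T i)) is ordered counterclockwise. *)
Definition iplus T i : 'I_3 := if ccw T then i + 1 else i + 2.
Definition iminus T i : 'I_3 := if ccw T then i + 2 else i + 1.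

Definition bubble T (x : R * R) : R := \prod_j bary T j x.

(* The polynomial quotient of the bubble by bary T i, see bubble_quotE. *)
Definition bubble_quot T i (x : R * R) : R := \prod_(j | j != i) bary T j x.

Lemma bubble_quotE T i x : bubble T x = bary T i x * bubble_quot T i x.
Proof. by rewrite /bubble (bigD1 i). Qed.

Definition peval (p : mpoly.mpoly 2 R) (x : R * R) : R :=
  mpoly.meval (fun j : 'I_2 => if j == 0 then x.1 else x.2) p.

(* Polynomial functions on the triangle of total degree at most m. As msize is
   1 + the degree, and 0 for the zero polynomial, this is {0} for m < 0. *)
Definition Pspace T m : set (tri T -> R) :=
  [set v : tri T -> R |
     exists2 p : mpoly.mpoly 2 R, (mpoly.msize p)%:Z <= m + 1 &
     forall x : tri T, v x = peval p (set_val x)].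

Definition tri_integral T (f : tri T -> R) : \bar R :=
  (\int[lebesgue_measure \x lebesgue_measure]_(x in tri T)
     ('valL_0 f x)%:E)%E.

(* The space Q_i^(r-2) of the triangle. *)
Definition Qspace T i (r : nat) : set (tri T -> R) :=
  [set v : tri T -> R | Pspace (r%:Z - 2) v /\
     forall q : tri T -> R, Pspace (r%:Z - 3) q ->
       tri_integral (fun x => bubble T (set_val x) *
                              bubble_quot T i (set_val x) * v x * q x) = 0%E].

Definition jacobi_on T i (a b c : R) (k n : nat) : tri T -> R :=
  fun x => tri_jacobi a b c k n (bary T i (set_val x))
    (bary T (iplus T i) (set_val x)) (bary T (iminus T i) (set_val x)).

End Triangle.

Arguments Pspace {R} T m.
Arguments Qspace {R} T i r.
Arguments jacobi_on {R} T i a b c k n.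

(* Main.v *)
Require Import Defs.
From mathcomp Require Import all_boot all_order all_algebra.
From mathcomp Require Import ring lra zify.
From mathcomp Require Import all_classical all_reals all_analysis.
From mathcomp Require Import measurable_realfun.
From mathcomp Require cauchyreals.
From mathcomp Require mpoly.
Import (canonicals, coercions) mpoly.
Import Order.TTheory GRing.Theory Num.Theory.
Import numFieldNormedType.Exports.
Local Open Scope classical_set_scope.
Local Open Scope ring_scope.
Set Implicit Arguments.
Unset Strict Implicit.
Unset Printing Implicit Defensive.

(** Write l, l+, l- for the barycentric coordinates attached to the edge i and
    to the next two edges, s = l+ + l- and d = l+ - l-, so that l = 1 - s, and
    let n = r - 2. Up to the factor 16 the weight of the orthogonality relation
    is w = (1 - s) (s^2 - d^2)^2.

    Orthogonality. In the coordinates s and u = d / s the triangle is a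
    rectangle, w ds dd is (1 - s) s^5 (1 - u^2)^2 ds du, and the k-th
    polynomial of the family is the product of s^k p(1 - 2 s) and q(u), where q
    is the Jacobi polynomial of degree k for (1 - u^2)^2 and p the one of
    degree n - k for (1 - s) s^(2k+5). Its integral against s^m d^j, with
    m + j < n, is therefore a product of two one-dimensional integrals
    (tri_jacobi_pol_orthogonal_monomial). If j < k, the integral in u vanishes
    by the orthogonality of q; otherwise s^(2k+5) splits off in the integral
    in s and leaves p against a polynomial of degree m + j - k < n - k
    (sum_angular_moment0, sum_radial_moment0). Both one-dimensional facts
    follow from Rodrigues' formula by repeated integration by parts
    (jacobi_orthogonal).

    The product formula for the moments of w (momentE) is obtained without a
    change of variables in the plane. If a polynomial is divisible by the
    bubble, the integrals of its partial derivatives over the triangle vanish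
    (integral_mderiv_bubble): Fubini's theorem reduces this to intervals whose
    endpoints lie on the boundary. Applied to a multiple of the radial field
    (s, d), and to a derivative in the direction where s is constant, this
    gives linear recurrences for the moments. The products of
    one-dimensional moments satisfy them too, and the recurrences determine
    their solution up to one constant (polar_moments).

    Spanning. Modulo polynomials of degree less than n, the k-th polynomial of
    the family is a combination of the monomials s^(n-l) d^l with l <= k, and
    the coefficient for l = k is not zero, being a product of two leading
    coefficients. So every polynomial of degree at most n is p1 + p2 with p1 in
    the span of the family and p2 of degree less than n
    (tri_jacobi_pol_span_mod). If p1 + p2 lies in the space Q, then p2 is
    orthogonal to itself, because p1 is orthogonal to p2. As w is positive
    inside the triangle, p2 vanishes on it (tri_int_definite). *)

(** * Integrals of polynomials in one variable *)

Section PolyIntegral.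
Variable R : realType.
Implicit Types (p q g h w : {poly R}) (a b t : R).

Local Notation mu := (@lebesgue_measure R).

Definition poly_int a b p : R := (\int[mu]_(t in `[a, b]) p.[t])%R.

Lemma integrable_horner a b p : mu.-integrable `[a, b] (EFin \o horner p).
Proof.
apply: continuous_compact_integrable; first exact: segment_compact.
by apply: continuous_subspaceT => t; exact: continuous_horner.
Qed.

Lemma poly_intD a b p q :
  poly_int a b (p + q) = poly_int a b p + poly_int a b q.
Proof.
rewrite /poly_int -RintegralD//; [|exact: integrable_horner..].
by apply: eq_Rintegral => t _; rewrite hornerD.
Qed.

Lemma poly_intZ a b c p : poly_int a b (c *: p) = c * poly_int a b p.
Proof.
rewrite /poly_int -RintegralZl//; last exact: integrable_horner.
by apply: eq_Rintegral => t _; rewrite hornerZ.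
Qed.

Lemma poly_int_sum a b (n : nat) (F : nat -> {poly R}) :
  poly_int a b (\sum_(i < n) F i) = \sum_(i < n) poly_int a b (F i).
Proof.
elim: n => [|n IH]; last by rewrite !big_ord_recr /= poly_intD IH.
by rewrite !big_ord0 -(scale0r 0) poly_intZ mul0r.
Qed.

Lemma integral_deriv_poly a b p : a <= b ->
  (\int[mu]_(t in `[a, b]) (p^`().[t])%:E = (p.[b] - p.[a])%:E)%E.
Proof.
rewrite le_eqVlt => /predU1P[->|ab].
  by rewrite subrr set_itv1 integral_set1.
rewrite (@continuous_FTC2 _ (horner p^`()) (horner p))//.
- by apply: continuous_subspaceT => t; exact: continuous_horner.
- split.
  + by move=> t _; exact: derivable_horner.
  + by apply: cvg_at_right_filter; exact: continuous_horner.
  + by apply: cvg_at_left_filter; exact: continuous_horner.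
- move=> t _; rewrite derive1E.
  by have dp := is_derive_poly p t; rewrite derive_val.
Qed.

Lemma poly_int_deriv a b p : a <= b -> poly_int a b p^`() = p.[b] - p.[a].
Proof. by move=> ab; rewrite /poly_int /Rintegral integral_deriv_poly. Qed.

(** Each differentiation costs at most one factor w. *)
Lemma dvdp_derivn w h n k : w ^+ (n + k) %| h -> w ^+ k %| h^`(n).
Proof.
elim: n h => [|n IH] h; first by rewrite derivn0.
rewrite derivSn addSn => /dvdpP[q ->]; apply: IH.
rewrite derivM dvdp_add//; first by rewrite dvdp_mull// exprS dvdp_mull.
by rewrite dvdp_mull// deriv_exp -mulrnAl dvdp_mull.
Qed.

(** Integration by parts, n times: the boundary terms vanish because w still
    divides the derivatives of h of order less than n, and in the end g has
    been differentiated away. *)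
Lemma poly_int_derivn_mul a b w h g n : a <= b -> root w a -> root w b ->
  w ^+ n %| h -> (size g <= n)%N -> poly_int a b (h^`(n) * g) = 0.
Proof.
move=> ab wa wb; elim: n g => [|n IH] g wh sg.
  move: sg; rewrite leqn0 size_poly_eq0 => /eqP ->.
  by rewrite mulr0 -(scale0r 0) poly_intZ mul0r.
have -> : h^`(n.+1) * g = (h^`(n) * g)^`() + (-1) *: (h^`(n) * g^`()).
  by rewrite derivM derivnS scaleN1r addrK.
rewrite poly_intD poly_intZ IH ?mulr0 ?addr0; last 2 first.
- by apply: dvdp_trans wh; rewrite exprS dvdp_mull.
- by case: (eqVneq g 0) => [->|g0]; rewrite ?deriv0 ?size_poly0// -ltnS
    (leq_trans (lt_size_deriv _)).
have wd : w %| h^`(n) by rewrite -(expr1 w); apply: dvdp_derivn; rewrite addn1.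
move: wd => /dvdpP[q ->].
rewrite poly_int_deriv// !hornerM (rootP wa) (rootP wb).
by rewrite !(mulr0, mul0r) subrr.
Qed.

End PolyIntegral.

(** * Jacobi polynomials with natural parameters *)

Section NatJacobi.
Variable R : realType.
Implicit Types (p q g h : {poly R}) (a b n k : nat).

Definition jacobi_weight a b : {poly R} := (1 - 'X) ^+ a * (1 + 'X) ^+ b.

Definition rodrigues_coef n : R := (-1) ^+ n / (2 ^+ n * n`!%:R).

Lemma rodrigues_coef_neq0 n : rodrigues_coef n != 0.
Proof.
by rewrite mulf_neq0 ?signr_eq0// invr_eq0 mulf_neq0// ?expf_neq0// pnatr_eq0
  -lt0n fact_gt0.
Qed.

Lemma horner_jacobi_weight a b t :
  (jacobi_weight a b).[t] = (1 - t) ^+ a * (1 + t) ^+ b.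
Proof. by rewrite !hornerE. Qed.

(** Real and natural powers agree only where the base is not negative; the
    interval being open, this is enough to identify the derivatives too. *)
Lemma derive1n_jacobi_weight a b n (t : R) : -1 < t < 1 ->
  derive1n n (fun s : R => (1 - s) `^ a%:R * (1 + s) `^ b%:R) t =
  ((jacobi_weight a b)^`(n)).[t].
Proof.
elim: n t => [|n IH] t t1.
  rewrite derive1n0 derivn0 horner_jacobi_weight.
  by move/andP: t1 => [t0 t1]; rewrite !powR_mulrn//; lra.
rewrite derive1nS derive1E.
rewrite (near_eq_derive _ (g := horner (jacobi_weight a b)^`(n))).
  have dp := is_derive_poly (jacobi_weight a b)^`(n) t.
  by rewrite derive_val derivnS.
have tI : t \in `]-1, 1[ by rewrite in_itv/=.
by apply: filterS (near_in_itvoo tI) => s; rewrite in_itv; exact: IH.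
Qed.

Lemma poly_eq_itv p q : (forall t : R, -1 < t < 1 -> p.[t] = q.[t]) -> p = q.
Proof.
move=> pq; apply/eqP; rewrite -subr_eq0; apply/negPn/negP => d0.
(* The numbers 1/2, 1/3, ... are more roots than the degree allows. *)
pose s := [seq (j.+2%:R : R)^-1 | j <- iota 0 (size (p - q)%R)].
have us : uniq s.
  rewrite map_inj_uniq ?iota_uniq// => i j /invr_inj /eqP.
  by rewrite eqr_nat => /eqP[].
suff rs : all (root (p - q)) s.
  by have := max_poly_roots d0 rs us; rewrite size_map size_iota ltnn.
apply/allP => _ /mapP[j _ ->]; rewrite rootE hornerD hornerN subr_eq0.
rewrite pq//.
have t0 : 0 < (j.+2%:R : R)^-1 by rewrite invr_gt0 ltr0n.
have t1 : (j.+2%:R : R)^-1 < 1 by rewrite invf_lt1 ?ltr0n// ltr1n.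
by rewrite t1 andbT (lt_trans _ t0)// ltrN10.
Qed.

(** For natural parameters both sides of Rodrigues' formula are polynomials, so
    it extends from the interval to an identity. *)
Lemma jacobi_rodrigues a b n :
  jacobi_weight a b * jacobi a%:R b%:R n =
  rodrigues_coef n *: (jacobi_weight (n + a) (n + b))^`(n).
Proof.
apply: poly_eq_itv => t tI.
rewrite hornerM hornerZ horner_jacobi_weight.
have := @jacobiP R a%:R b%:R n t tI.
rewrite -!natrD derive1n_jacobi_weight// => <-.
by move/andP: tI => [t0 t1]; rewrite !powR_mulrn//; lra.
Qed.

Lemma size_onemX : size (1 - 'X : {poly R}) = 2.
Proof. by rewrite -opprB size_polyN -polyC1 size_XsubC. Qed.

Lemma size_onepX : size (1 + 'X : {poly R}) = 2.
Proof. by rewrite addrC -polyC1 -[_%:P]opprK -polyCN size_XsubC. Qed.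

Lemma jacobi_weight_neq0 a b : jacobi_weight a b != 0.
Proof.
by rewrite mulf_neq0// expf_neq0// -size_poly_gt0 ?size_onemX ?size_onepX.
Qed.

Lemma size_jacobi_weight a b : size (jacobi_weight a b) = (a + b).+1.
Proof.
rewrite size_mul ?expf_neq0// -?size_poly_gt0 ?size_onemX ?size_onepX//.
have e p k : size p = 2%N -> size (p ^+ k) = k.+1.
  by move=> sp; rewrite -[LHS]prednK ?size_exp ?sp ?mul1n// lt0n size_poly_eq0
    expf_neq0// -size_poly_gt0 sp.
by rewrite !e ?size_onemX ?size_onepX// addnS.
Qed.

(** Compare degrees in Rodrigues' formula: in characteristic zero, n derivatives
    lower the degree by exactly n. *)
Lemma size_jacobi a b n : size (jacobi a%:R b%:R n : {poly R}) = n.+1.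
Proof.
have := congr1 (fun p : {poly R} => size p) (jacobi_rodrigues a b n).
rewrite size_scale ?rodrigues_coef_neq0// cauchyreals.size_derivn.
rewrite size_jacobi_weight.
case: (eqVneq (jacobi a%:R b%:R n : {poly R}) 0) => [->|j0].
  by rewrite mulr0 size_poly0 => /esym/eqP; lia.
rewrite size_mul ?jacobi_weight_neq0// size_jacobi_weight.
by move: (size _) => s; lia.
Qed.

Lemma jacobi_orthogonal a b n g : (size g <= n)%N ->
  poly_int (-1) 1 (jacobi_weight a b * jacobi a%:R b%:R n * g) = 0.
Proof.
move=> sg; rewrite jacobi_rodrigues -scalerAl poly_intZ.
rewrite (@poly_int_derivn_mul _ _ _ ((1 - 'X) * (1 + 'X))) ?mulr0//.
- by rewrite rootE !hornerE subrr mulr0.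
- by rewrite rootE !hornerE subrr mul0r.
- by rewrite exprMn dvdp_mul// exprD dvdp_mulr.
Qed.

End NatJacobi.

(** * Bounded intersections of half-lines *)

Section AffineSections.
Variables (R : realType) (I : finType).
Implicit Types (al be : I -> R) (t : R).

(** This is how a line parallel to an axis meets the triangle: along the line
    every barycentric coordinate is an affine function. *)
Definition halfline_cap al be : set R :=
  [set t | forall j, 0 <= al j + be j * t].

(** The bound is the supremum: the conditions are closed, so they hold there,
    and if all of them were strict they would still hold a little further. *)
Lemma halfline_cap_max al be (N : R) : halfline_cap al be !=set0 ->
  (forall t, halfline_cap al be t -> t <= N) ->
  exists b, [/\ halfline_cap al be b, forall t, halfline_cap al be t -> t <= b &
                exists j, al j + be j * b = 0].
Proof.
move=> S0 SN; set S := halfline_cap al be in S0 SN *.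
pose b := sup S.
have ub t : S t -> t <= b by move=> St; apply: ub_le_sup => //; exists N.
have Sb : S b.
  move=> j; case: (leP 0 (be j)) => bj.
    case: S0 => t St; apply: le_trans (St j) _.
    by rewrite lerD2l ler_wpM2l ?ub.
  have : b <= - al j / be j.
    apply: ge_sup => // t St; rewrite ler_ndivlMr// mulrC.
    by have := St j; lra.
  by rewrite ler_ndivlMr//; lra.
exists b; split=> //; apply: contrapT => /forallNP n0.
have pos j : 0 < al j + be j * b.
  by rewrite lt_neqAle Sb andbT eq_sym; apply/eqP; exact: n0.
have near_pos : \forall t \near b^'+, forall j, 0 < al j + be j * t.
  apply: filter_forall => j; apply: (cvgr_gt (al j + be j * b)) (pos j).
  apply: cvg_at_right_filter; apply: cvgD; first exact: cvg_cst.
  by apply: cvgM; [exact: cvg_cst|exact: cvg_id].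
have [t [bt St]] : exists t, b < t /\ forall j, 0 < al j + be j * t.
  by apply: (@filter_ex _ (b^'+)); apply: filterI => //; exact: nbhs_right_gt.
by have := ub t (fun j => ltW (St j)); rewrite leNgt bt.
Qed.

Lemma halfline_cap_itv al be (N : R) : halfline_cap al be !=set0 ->
  (forall t, halfline_cap al be t -> `|t| <= N) ->
  exists a b, [/\ a <= b, halfline_cap al be = `[a, b]%classic,
                  exists j, al j + be j * a = 0 &
                  exists j, al j + be j * b = 0].
Proof.
move=> S0 SN.
have opp t : halfline_cap al (\- be) t <-> halfline_cap al be (- t).
  by split=> St j; have := St j => /=; rewrite mulrN mulNr.
have [b [Sb ub [jb b0]]] : exists b, [/\ halfline_cap al be b,
    forall t, halfline_cap al be t -> t <= b & exists j, al j + be j * b = 0].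
  by apply: (@halfline_cap_max _ _ N) => // t /SN; rewrite ler_norml => /andP[].
(* The lower end is the upper end of the reflected set. *)
have [a [Sa ua [ja a0]]] : exists b, [/\ halfline_cap al (\- be) b,
    forall t, halfline_cap al (\- be) t -> t <= b &
    exists j, al j + (\- be) j * b = 0].
  apply: (@halfline_cap_max _ _ N) => [|t /opp/SN].
    by case: S0 => t St; exists (- t); apply/opp; rewrite opprK.
  by rewrite normrN ler_norml => /andP[].
exists (- a), b; split.
- by apply: ub; apply/opp.
- apply/seteqP; split=> [t St|t] /=; rewrite in_itv/=.
    rewrite (ub _ St) andbT lerNl; apply: ua.
    by apply/opp; rewrite opprK.
  move=> /andP[at_ tb] j.
  move/opp : Sa => /(_ j) Sa; move: Sb => /(_ j) Sb.
  case: (leP 0 (be j)) => bj.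
    by apply: le_trans Sa _; rewrite lerD2l ler_wpM2l.
  by apply: le_trans Sb _; rewrite lerD2l ler_wnM2l// ltW.
- by exists ja; move: a0 => /=; rewrite mulrN mulNr.
- by exists jb.
Qed.

Lemma integral_deriv_halfline_cap al be (N : R) (p : {poly R}) :
  (forall t, halfline_cap al be t -> `|t| <= N) ->
  (forall t j, al j + be j * t = 0 -> p.[t] = 0) ->
  (\int[@lebesgue_measure R]_(t in halfline_cap al be) (p^`().[t])%:E = 0)%E.
Proof.
move=> SN p0; have [->|/set0P S0] := eqVneq (halfline_cap al be) set0.
  by rewrite integral_set0.
have [a [b [ab -> [ja a0] [jb b0]]]] := halfline_cap_itv S0 SN.
by rewrite integral_deriv_poly// (p0 _ _ a0) (p0 _ _ b0) subrr.
Qed.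

End AffineSections.

(** * Polynomials in the plane *)

Section PlanePolynomials.
Variable R : realType.

Local Notation poly2 := (mpoly.mpoly 2 R).
Implicit Types (p q : poly2) (x : R * R).

Definition coord_pol (k : 'I_2) : poly2 := mpoly.mpolyX R (mpoly.mnm1 k).
Definition const_pol (c : R) : poly2 := mpoly.mpolyC 2 c.

Lemma pevalD p q x : peval (p + q) x = peval p x + peval q x.
Proof. by rewrite /peval mpoly.mevalD. Qed.

Lemma pevalM p q x : peval (p * q) x = peval p x * peval q x.
Proof. by rewrite /peval mpoly.mevalM. Qed.

Lemma pevalN p x : peval (- p) x = - peval p x.
Proof. by rewrite /peval mpoly.mevalN. Qed.

Lemma pevalZ c p x : peval (c *: p) x = c * peval p x.
Proof. by rewrite /peval mpoly.mevalZ. Qed.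

Lemma peval0 x : peval 0 x = 0. Proof. by rewrite /peval mpoly.meval0. Qed.

Lemma peval1 x : peval 1 x = 1. Proof. by rewrite /peval mpoly.meval1. Qed.

Lemma peval_exp p k x : peval (p ^+ k) x = peval p x ^+ k.
Proof. by elim: k => [|k IH]; rewrite ?expr0 ?peval1// !exprS pevalM IH. Qed.

Lemma peval_sum (J : Type) (s : seq J) (F : J -> poly2) x :
  peval (\sum_(j <- s) F j) x = \sum_(j <- s) peval (F j) x.
Proof.
elim: s => [|j s IH]; first by rewrite !big_nil peval0.
by rewrite !big_cons pevalD IH.
Qed.

Lemma pevalC c x : peval (const_pol c) x = c.
Proof. by rewrite /peval mpoly.mevalC. Qed.

Lemma pevalX0 x : peval (coord_pol 0) x = x.1.
Proof. by rewrite /peval mpoly.mevalXU. Qed.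

Lemma pevalX1 x : peval (coord_pol 1) x = x.2.
Proof. by rewrite /peval mpoly.mevalXU. Qed.

(** Facts about polynomial functions that pass to sums and products need a proof
    only for constants and coordinates. *)
Lemma poly2_ind (P : poly2 -> Prop) :
  (forall c, P (const_pol c)) -> P (coord_pol 0) -> P (coord_pol 1) ->
  (forall p q, P p -> P q -> P (p + q)) ->
  (forall p q, P p -> P q -> P (p * q)) -> forall p, P p.
Proof.
move=> PC P0 P1 PD PM; elim/mpoly.mpolyind => [|c m p _ _ Pp].
  by rewrite -(mpoly.mpolyC0 2 R); exact: PC.
apply: (PD) => //; rewrite -mpoly.mul_mpolyC; apply: (PM); first exact: PC.
have PX k p' : P p' -> P (p' ^+ k).
  move=> Pp'; elim: k => [|k IH].
    by rewrite expr0 -mpoly.mpolyC1; exact: PC.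
  by rewrite exprS; apply: PM.
rewrite mpoly.mpolyXE_id !big_ord_recl big_ord0 mulr1.
apply: PM; apply: PX; first exact: P0.
by rewrite (_ : lift _ _ = 1) //; exact: val_inj.
Qed.

Lemma continuous_peval p : continuous (peval p : R * R -> R).
Proof.
elim/poly2_ind: p => [c|||p q cp cq|p q cp cq] x.
- rewrite (_ : peval _ = cst c); first exact: cvg_cst.
  by apply/funext => y; exact: pevalC.
- rewrite (_ : peval _ = fst); first exact: cvg_fst.
  by apply/funext => y; exact: pevalX0.
- rewrite (_ : peval _ = snd); first exact: cvg_snd.
  by apply/funext => y; exact: pevalX1.
- rewrite (_ : peval _ = peval p \+ peval q).
    by apply: cvgD; [exact: cp|exact: cq].
  by apply/funext => y; exact: pevalD.
- rewrite (_ : peval _ = peval p \* peval q).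
    by apply: cvgM; [exact: cp|exact: cq].
  by apply/funext => y; exact: pevalM.
Qed.

Lemma measurable_peval p : measurable_fun setT (peval p : R * R -> R).
Proof.
elim/poly2_ind: p => [c|||p q cp cq|p q cp cq].
- rewrite (_ : peval _ = cst c); first exact: measurable_cst.
  by apply/funext => y; exact: pevalC.
- rewrite (_ : peval _ = fst); first exact: measurable_fst.
  by apply/funext => y; exact: pevalX0.
- rewrite (_ : peval _ = snd); first exact: measurable_snd.
  by apply/funext => y; exact: pevalX1.
- rewrite (_ : peval _ = peval p \+ peval q); first exact: measurable_funD.
  by apply/funext => y; exact: pevalD.
- rewrite (_ : peval _ = peval p \* peval q); first exact: measurable_funM.
  by apply/funext => y; exact: pevalM.
Qed.

Lemma bounded_peval p (N : R) : exists C, forall x,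
  `|x.1| <= N -> `|x.2| <= N -> `|peval p x| <= C.
Proof.
elim/poly2_ind: p => [c|||p q [C hC] [C' hC']|p q [C hC] [C' hC']].
- by exists `|c| => x _ _; rewrite pevalC.
- by exists N => x h _; rewrite pevalX0.
- by exists N => x _ h; rewrite pevalX1.
- exists (C + C') => x h1 h2; rewrite pevalD.
  by apply: le_trans (ler_normD _ _) _; rewrite lerD ?hC ?hC'.
- exists (C * C') => x h1 h2; rewrite pevalM normrM.
  by rewrite ler_pM ?hC ?hC'.
Qed.

Lemma mderiv_coord_pol (k j : 'I_2) :
  mpoly.mderiv k (coord_pol j) = const_pol (j == k)%:R.
Proof.
rewrite /coord_pol mpoly.mderivX mpoly.mnm1E.
have [->|_] := eqVneq j k; last by rewrite scale0r /const_pol mpoly.mpolyC0.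
rewrite -[X in mpoly.mnm_sub X _]mpoly.add0m mpoly.addmK mpoly.mpolyX0.
by rewrite scale1r /const_pol mpoly.mpolyC1.
Qed.

Definition on_line (k : 'I_2) (x : R * R) (t : R) : R * R :=
  if k == 0 then (t, x.2) else (x.1, t).

(** This turns partial derivatives of plane polynomials into derivatives in
    one variable, to which the fundamental theorem of calculus applies. *)
Lemma peval_line p (k : 'I_2) (x : R * R) : exists P : {poly R}, forall t,
  peval p (on_line k x t) = P.[t] /\
  peval (mpoly.mderiv k p) (on_line k x t) = P^`().[t].
Proof.
elim/poly2_ind: p => [c|||p q [P hP] [Q hQ]|p q [P hP] [Q hQ]].
- exists c%:P => t; rewrite pevalC hornerC mpoly.mderivC peval0 derivC.
  by rewrite horner0.
- exists (if k == 0 then 'X else (x.1)%:P) => t.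
  rewrite mderiv_coord_pol pevalC pevalX0 /on_line [0 == k]eq_sym.
  by case: (k == 0) => /=; rewrite ?(derivX, derivC) ?hornerE.
- exists (if k == 0 then (x.2)%:P else 'X) => t.
  rewrite mderiv_coord_pol pevalC pevalX1 /on_line.
  rewrite (_ : (1 == k) = (k != 0)); last by case: k => [[|[|]]].
  by case: (k == 0) => /=; rewrite ?(derivX, derivC) ?hornerE.
- exists (P + Q) => t; have [hp dp] := hP t; have [hq dq] := hQ t.
  by rewrite mpoly.mderivD !pevalD derivD !hornerD hp dp hq dq.
- exists (P * Q) => t; have [hp dp] := hP t; have [hq dq] := hQ t.
  rewrite mpoly.mderivM !(pevalD, pevalM) derivM !(hornerD, hornerM).
  by rewrite hp dp hq dq.
Qed.

End PlanePolynomials.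

(** * Integration over a triangle *)

Section TriangleIntegral.
Variables (R : realType) (T : triangle R).

Local Notation poly2 := (mpoly.mpoly 2 R).
Local Notation mu := (@lebesgue_measure R).
Local Notation mu2 := (mu \x mu)%E.
Implicit Types (p q : poly2) (x : R * R) (i j k : 'I_3).

Lemma bary_coord x : x.1 = \sum_j bary T j x * (vertex T j).1 /\
  x.2 = \sum_j bary T j x * (vertex T j).2.
Proof.
have := vertex_noncollinear T.
by rewrite !sum_ord3 !baryE !add0r !ord3D /orient => D0; split; field.
Qed.

Lemma triE : tri T = [set x | forall j, 0 <= bary T j x].
Proof.
have D0 := vertex_noncollinear T.
apply/seteqP; split=> [x [c [c0 c1 x1 x2]] j|x h] /=.
  suff -> : bary T j x = c j by exact: c0.
  rewrite baryE; apply: canLR (mulfK D0) _.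
  move: c1 x1 x2; rewrite !sum_ord3 => c1 x1 x2.
  have {}c1 : c 0 = 1 - c 1 - c 2 by rewrite -c1; ring.
  by case: (ord3P j) => ->; rewrite ?add0r ?ord3D /orient x1 x2 c1; ring.
have [x1 x2] := bary_coord x.
by exists (bary T ^~ x); split=> //; exact: sum_bary.
Qed.

(** Expanded in the Cartesian coordinates, so that the partial derivatives are
    visibly constant. *)
Definition bary_pol j : poly2 :=
  let y := vertex T (j + 1) in let z := vertex T (j + 2) in
  let D := orient (vertex T 0) (vertex T 1) (vertex T 2) in
  const_pol ((y.1 * z.2 - z.1 * y.2) / D) +
  const_pol ((y.2 - z.2) / D) * coord_pol _ 0 +
  const_pol ((z.1 - y.1) / D) * coord_pol _ 1.

Lemma peval_bary_pol j x : peval (bary_pol j) x = bary T j x.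
Proof.
rewrite baryE /bary_pol !(pevalD, pevalM, pevalC, pevalX0, pevalX1) /orient.
by ring.
Qed.

Lemma mderiv_bary_pol (k : 'I_2) j : mpoly.mderiv k (bary_pol j) =
  let y := vertex T (j + 1) in let z := vertex T (j + 2) in
  let D := orient (vertex T 0) (vertex T 1) (vertex T 2) in
  const_pol (if k == 0 then (y.2 - z.2) / D else (z.1 - y.1) / D).
Proof.
rewrite /bary_pol !(mpoly.mderivD, mpoly.mderivM, mderiv_coord_pol) !mpoly.mderivC.
rewrite !mul0r !add0r.
have [->|k0] := eqVneq k 0.
  rewrite /const_pol mpoly.mpolyC1 mulr1.
  by rewrite (_ : (1 == 0 :> 'I_2) = false)// mpoly.mpolyC0 mulr0 addr0.
have -> : k = 1 by case: k k0 => [[|[|]]]// *; exact: val_inj.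
by rewrite /const_pol mpoly.mpolyC1 mpoly.mpolyC0 mulr1 mulr0 add0r.
Qed.

Definition tri_int p : R := (\int[mu2]_(x in tri T) peval p x)%R.

Lemma measurable_tri : measurable (tri T).
Proof.
have -> : tri T =
    \bigcap_(j in [set: 'I_3]) (peval (bary_pol j) @^-1` `[0, +oo[).
  rewrite triE; apply/seteqP; split=> x h j /=.
    by move=> _; rewrite in_itv/= andbT peval_bary_pol.
  by have := h j Logic.I; rewrite /= in_itv/= andbT peval_bary_pol.
apply: fin_bigcap_measurable => // j _.
by rewrite -[X in measurable X]setTI; apply: measurable_peval.
Qed.

Lemma bounded_tri : exists N : R, forall x,
  tri T x -> `|x.1| <= N /\ `|x.2| <= N.
Proof.
pose N := \sum_j (`|(vertex T j).1| + `|(vertex T j).2|).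
exists N => x [c [c0 c1 -> ->]].
have cle j : c j <= 1.
  by rewrite -c1 (bigD1 j)//= lerDl sumr_ge0.
split; (apply: le_trans (ler_norm_sum _ _ _) _; apply: ler_sum => j _).
  by rewrite normrM ger0_norm// (le_trans (ler_piMl _ (cle j)))// lerDl.
by rewrite normrM ger0_norm// (le_trans (ler_piMl _ (cle j)))// lerDr.
Qed.

Lemma finite_tri : (mu2 (tri T) < +oo)%E.
Proof.
have [N hN] := bounded_tri.
have sub : tri T `<=` `[- N, N] `*` `[- N, N].
  move=> x /hN[]; rewrite !ler_norml => h1 h2.
  by split; rewrite /= in_itv.
apply: (@le_lt_trans _ _ (mu2 (`[- N, N] `*` `[- N, N]))).
  apply: le_measure => //; rewrite inE; first exact: measurable_tri.
  exact: measurableX.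
rewrite product_measure1E//= lebesgue_measure_itv /=.
by case: ifPn => _; rewrite ?mule0// -EFinD -EFinM ltry.
Qed.

Lemma integrable_tri p : mu2.-integrable (tri T) (EFin \o peval p).
Proof.
apply: measurable_bounded_integrable.
- exact: measurable_tri.
- exact: finite_tri.
- apply: measurable_funTS; exact: measurable_peval.
- have [N hN] := bounded_tri; have [C hC] := bounded_peval p N.
  exists C; split; first exact: num_real.
  move=> M CM x /hN[h1 h2] /=.
  by apply: le_trans (ltW CM); exact: hC.
Qed.

Lemma integral_tri p :
  (\int[mu2]_(x in tri T) (peval p x)%:E = (tri_int p)%:E)%E.
Proof.
rewrite /tri_int /Rintegral fineK//.
by apply: integrable_fin_num; [exact: measurable_tri|exact: integrable_tri].
Qed.

Lemma tri_intD p q : tri_int (p + q) = tri_int p + tri_int q.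
Proof.
rewrite /tri_int -RintegralD; [|exact: measurable_tri|exact: integrable_tri..].
by apply: eq_Rintegral => x _; exact: pevalD.
Qed.

Lemma tri_intZ c p : tri_int (c *: p) = c * tri_int p.
Proof.
rewrite /tri_int -RintegralZl; [|exact: measurable_tri|exact: integrable_tri].
by apply: eq_Rintegral => x _; exact: pevalZ.
Qed.

Lemma tri_integralE (f : tri T -> R) p :
  (forall x : tri T, f x = peval p (set_val x)) ->
  tri_integral f = (tri_int p)%:E.
Proof.
move=> fp; have -> : f = sigL (tri T) (peval p) by apply/funext => x; exact: fp.
rewrite -integral_tri /tri_integral; apply: eq_integral => x xT; congr EFin.
have -> : 'valL_0 (sigL (tri T) (peval p)) = patch (fun=> 0) (tri T) (peval p).
  by rewrite -sigLK.
by rewrite patchE xT.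
Qed.

Definition bubble_pol : poly2 := \prod_j bary_pol j.

Lemma peval_bubble_pol x : peval bubble_pol x = bubble T x.
Proof.
rewrite /bubble /bubble_pol -!big_enum.
elim: (enum _) => [|j s IH]; first by rewrite !big_nil peval1.
by rewrite !big_cons pevalM peval_bary_pol IH.
Qed.

Lemma bary_line (k : 'I_2) x j : exists al be : R, forall t,
  bary T j (on_line k x t) = al + be * t.
Proof.
pose y := vertex T (j + 1); pose z := vertex T (j + 2).
pose D := orient (vertex T 0) (vertex T 1) (vertex T 2).
exists (if k == 0 then (y.1 * z.2 - z.1 * y.2 + (z.1 - y.1) * x.2) / D else
        (y.1 * z.2 - z.1 * y.2 + (y.2 - z.2) * x.1) / D).
exists (if k == 0 then (y.2 - z.2) / D else (z.1 - y.1) / D) => t.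
rewrite baryE /on_line -/y -/z -/D.
by case: (k == 0); rewrite /orient /=; ring.
Qed.

(** The inner integral of Fubini's theorem: the section of the triangle is an
    interval, and the bubble vanishes at its endpoints. *)
Lemma integral_section (k : 'I_2) x p :
  (\int[mu]_t ((peval (mpoly.mderiv k (bubble_pol * p)) \_ (tri T))
     (on_line k x t))%:E = 0)%E.
Proof.
have /choice[al /choice[be ab]] := bary_line k x.
have [P hP] := peval_line (bubble_pol * p) k x.
have secE t : tri T (on_line k x t) <-> halfline_cap al be t.
  by rewrite triE /halfline_cap /=; split=> h j; [rewrite -ab|rewrite ab].
transitivity (\int[mu]_(t in halfline_cap al be) (P^`().[t])%:E)%E.
  rewrite [RHS]integral_mkcond; apply: eq_integral => t _.
  rewrite !patchE; have [tS|tS] := boolP (t \in halfline_cap al be).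
    by rewrite mem_set; [rewrite (hP t).2|apply/secE/set_mem].
  by rewrite memNset// => /secE/mem_set; apply/negP.
have [N hN] := bounded_tri.
apply: (@integral_deriv_halfline_cap _ _ _ _ N) => [t|t j h].
  move=> /secE/hN[]; rewrite /on_line; by case: ifP.
rewrite -(hP t).1 pevalM peval_bubble_pol /bubble (bigD1 j)//= ab h.
by rewrite !mul0r.
Qed.

(** The divergence theorem in the case without boundary term, proved by
    integrating along the direction of differentiation first. *)
Lemma integral_mderiv_bubble (k : 'I_2) p :
  tri_int (mpoly.mderiv k (bubble_pol * p)) = 0.
Proof.
pose f := EFin \o (peval (mpoly.mderiv k (bubble_pol * p)) \_ (tri T)).
have If : mu2.-integrable setT f.
  rewrite /f -restrict_EFin; apply: (integrable_mkcond _ _).1.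
    exact: measurable_tri.
  exact: integrable_tri.
apply: EFin_inj; rewrite -integral_tri integral_mkcond.
transitivity (\int[mu2]_x f x)%E; first by rewrite /f -restrict_EFin.
have [k0|k0] := boolP (k == 0).
- rewrite -integral21_prod_meas1//; apply: integral0_eq => y _.
  rewrite /fubini_G -[RHS](integral_section k (0, y) p).
  by apply: eq_integral => t _; rewrite /f /on_line k0.
- rewrite -integral12_prod_meas1//; apply: integral0_eq => y _.
  rewrite /fubini_F -[RHS](integral_section k (y, 0) p).
  by apply: eq_integral => t _; rewrite /f /on_line (negbTE k0).
Qed.

Lemma bary_affine j (x y : R * R) t :
  bary T j (x.1 + t * (y.1 - x.1), x.2 + t * (y.2 - x.2)) =
  bary T j x + t * (bary T j y - bary T j x).
Proof. by rewrite !baryE /orient /=; ring. Qed.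

Definition interior_tri x := forall j, 0 < bary T j x.

(** On the segment from x to the centroid all points but x are interior, and a
    polynomial that does not vanish at x does not vanish near x. *)
Lemma interior_dense p x : tri T x -> peval p x != 0 ->
  exists2 y, interior_tri y & peval p y != 0.
Proof.
rewrite triE => Tx px.
pose g : R * R := (\sum_j 3^-1 * (vertex T j).1, \sum_j 3^-1 * (vertex T j).2).
have bg j : bary T j g = 3^-1.
  rewrite baryE; apply: canLR (mulfK (vertex_noncollinear T)) _.
  rewrite /g !sum_ord3 /orient /=.
  by case: (ord3P j) => ->; rewrite ?add0r ?ord3D; field.
pose z t : R * R := (x.1 + t * (g.1 - x.1), x.2 + t * (g.2 - x.2)).
have cz1 (a b : R) : a + t * (b - a) @[t --> (0 : R)] --> a.
  rewrite -[X in _ --> X]addr0 -[X in _ --> _ + X](mul0r (b - a)).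
  by apply: cvgD; [exact: cvg_cst|apply: cvgM; [exact: cvg_id|exact: cvg_cst]].
have cz : z t @[t --> (0 : R)] --> (x.1, x.2).
  exact: (cvg_pair (cz1 x.1 g.1) (cz1 x.2 g.2)).
rewrite -surjective_pairing in cz.
have cp : peval p (z t) @[t --> (0 : R)] --> peval p x.
  by apply: cvg_comp cz _; exact: continuous_peval.
have near0 : \forall t \near (0 : R)^'+, peval p (z t) != 0.
  apply: (cvgr_neq0 (peval p x)) => //.
  exact: cvg_at_right_filter.
have [t [[t0 t1] pt]] : exists t : R, (0 < t /\ t < 1) /\ peval p (z t) != 0.
  apply: (@filter_ex _ ((0 : R)^'+)); apply: filterI => //; apply: filterI.
    exact: nbhs_right_gt.
  exact: nbhs_right_lt.
exists (z t) => // j; rewrite bary_affine bg.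
by have := Tx j; nra.
Qed.

(** A small rectangle at x, on which p exceeds half of its value at x, already
    contributes a positive amount. *)
Lemma tri_int_pos p : (forall x, tri T x -> 0 <= peval p x) ->
  (exists2 x, interior_tri x & 0 < peval p x) -> 0 < tri_int p.
Proof.
move=> p0 [x xi px].
have near_in : \forall y \near x, forall j, 0 < peval (bary_pol j) y.
  apply: (@filter_forall _ _ _ _ (nbhs_filter x)) => j.
  apply: (cvgr_gt _ (@continuous_peval R (bary_pol j) x)).
  by rewrite peval_bary_pol; exact: xi.
have near_big : \forall y \near x, peval p x / 2 < peval p y.
  by apply: (cvgr_gt _ (@continuous_peval R p x)); lra.
have near_box := @filterI _ _ (nbhs_filter x) _ _ near_in near_big.
have [e e0 he] : exists2 e : R, 0 < e & forall y,
    x.1 < y.1 < x.1 + e -> x.2 < y.2 < x.2 + e ->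
    (forall j, 0 < peval (bary_pol j) y) /\ peval p x / 2 < peval p y.
  have [e /= e0 he] := (nbhs_ballP _ _).1 near_box.
  exists e => // y /andP[h1 h2] /andP[h3 h4]; apply: he.
  split; rewrite /ball /= ltr_norml; apply/andP; split; lra.
pose B : set (R * R) := `]x.1, x.1 + e[ `*` `]x.2, x.2 + e[.
have BT : B `<=` tri T.
  move=> y [] /=; rewrite !in_itv/= => h1 h2; rewrite triE => j.
  by rewrite -peval_bary_pol; apply/ltW/(he y h1 h2).1.
have mB : measurable B by exact: measurableX.
have muB : mu2 B = (e * e)%:E.
  rewrite /B product_measure1E//= !lebesgue_measure_itv /= !lte_fin !ltrDl e0.
  by rewrite -!EFinD -EFinM ![_ + e - _]addrAC !subrr !add0r.
have : ((peval p x / 2 * (e * e))%:E <= (tri_int p)%:E)%E.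
  rewrite -integral_tri.
  apply: (@le_trans _ _ (\int[mu2]_(x in B) (peval p x)%:E)%E); last first.
    apply: ge0_subset_integral => //; first exact: measurable_tri.
      by have /integrableP[] := integrable_tri p.
  apply: (@le_trans _ _ (\int[mu2]_(y in B) (peval p x / 2)%:E)%E).
    by rewrite integral_cst// EFinM [X in (_ <= _ * X)%E]muB.
  apply: ge0_le_integral => //.
  - by move=> y _; rewrite lee_fin divr_ge0// ltW.
  - by apply/measurable_EFinP/measurable_funTS; exact: measurable_peval.
  - move=> y [] /=; rewrite !in_itv/= => h1 h2.
    by rewrite lee_fin; apply/ltW/(he y h1 h2).2.
rewrite lee_fin; apply: lt_le_trans.
by rewrite mulr_gt0 ?mulr_gt0// invr_gt0.
Qed.

Lemma tri_int_definite w p :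
  (forall x, tri T x -> 0 <= peval w x) ->
  (forall x, interior_tri x -> 0 < peval w x) ->
  tri_int (w * p * p) = 0 -> forall x, tri T x -> peval p x = 0.
Proof.
move=> w0 wi I0 x Tx; apply/eqP/negPn/negP => px.
have [y yi py] := interior_dense Tx px.
suff : 0 < tri_int (w * p * p) by rewrite I0 ltxx.
apply: tri_int_pos => [z Tz|].
  by rewrite !pevalM -mulrA mulr_ge0 ?w0// -expr2 sqr_ge0.
exists y => //; rewrite !pevalM -mulrA mulr_gt0 ?wi// -expr2.
by rewrite lt_neqAle sqr_ge0 eq_sym sqrf_eq0 py.
Qed.

End TriangleIntegral.

(** * Moments of the two one-dimensional weights *)

Section PolarMoments.
Variable R : realType.
Implicit Types (j e : nat).

(** The substitution s = (1 - t) / 2 from t in [-1, 1] to s in [0, 1], where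
    t = 1 - 2 s is the argument of the Jacobi polynomial in s. *)
Definition half_onemX : {poly R} := 2^-1 *: (1 - 'X).

Definition angular_moment j : R := poly_int (-1) 1 (jacobi_weight R 2 2 * 'X^j).

(** Up to a constant factor, the integral of (1 - s) s^(e+5) over [0, 1]. *)
Definition radial_moment e : R :=
  poly_int (-1) 1 (jacobi_weight R 5 1 * half_onemX ^+ e).

Lemma lerN1_1 : -1 <= 1 :> R. Proof. exact: le_trans (lerN10 _) ler01. Qed.

Lemma poly_int_deriv_root (p : {poly R}) : root p 1 -> root p (-1) ->
  poly_int (-1) 1 p^`() = 0.
Proof.
by move=> p1 p_1; rewrite poly_int_deriv ?lerN1_1// (rootP p1) (rootP p_1) subrr.
Qed.

(** The derivative of (1 - u^2)^3 u^(j+1) has integral zero. *)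
Lemma angular_moment_rec j :
  (j + 7)%:R * angular_moment j.+2 = (j + 1)%:R * angular_moment j.
Proof.
apply/eqP; rewrite -subr_eq0 -mulNr -!poly_intZ -poly_intD.
rewrite (_ : _ + _ = (- (jacobi_weight R 3 3 * 'X^(j.+1)))^`()); last first.
  rewrite /jacobi_weight !(derivN, derivM, deriv_exp, derivB, derivD, derivX).
  rewrite -polyC1 derivC -!mul_polyC !exprS /= !natrD.
  by rewrite !(polyCN, polyCD, polyC_natr, polyC1) -mulr_natl; ring.
by rewrite poly_int_deriv_root// rootE hornerN hornerM horner_jacobi_weight
  subrr expr0n;
  rewrite !(mulr0, mul0r) oppr0.
Qed.

Lemma angular_moment1 : angular_moment 1 = 0.
Proof.
suff : (- 6) * angular_moment 1 = 0.
  by move/eqP; rewrite mulf_eq0 oppr_eq0 pnatr_eq0 => /eqP.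
rewrite /angular_moment -poly_intZ.
rewrite (_ : _ *: _ = (jacobi_weight R 3 3)^`()); last first.
  rewrite /jacobi_weight !(derivM, deriv_exp, derivB, derivD, derivX).
  by rewrite -polyC1 derivC -!mul_polyC polyCN polyC_natr polyC1 /=; ring.
by rewrite poly_int_deriv_root// rootE horner_jacobi_weight subrr expr0n;
  rewrite !(mulr0, mul0r).
Qed.

Lemma angular_moment0 : angular_moment 0 = 16 / 15.
Proof.
suff : 15 * angular_moment 0 = 16 by move=> <-; field.
rewrite /angular_moment -poly_intZ.
rewrite (_ : _ *: _ = (15 *: 'X - 10 *: 'X^3 + 3 *: 'X^5)^`()); last first.
  rewrite /jacobi_weight !(derivD, derivN, derivZ, derivXn, derivX).
  by rewrite -!mul_polyC !polyC_natr expr0 /=; ring.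
rewrite poly_int_deriv ?lerN1_1//.
by rewrite !(hornerD, hornerN, hornerZ, hornerXn, hornerX); ring.
Qed.

(** As 1 + t = 2 - (1 - t), the integrand has a primitive made of two powers of
    1 - t. *)
Lemma radial_momentE e : radial_moment e = 128 / ((e + 6)%:R * (e + 7)%:R).
Proof.
have p6 : (e + 6)%:R != 0 :> R by rewrite pnatr_eq0 addnC.
have p7 : (e + 7)%:R != 0 :> R by rewrite pnatr_eq0 addnC.
suff : (e + 6)%:R * (e + 7)%:R * radial_moment e = 128.
  by move=> <-; rewrite mulrAC divff ?mul1r// mulf_neq0.
rewrite /radial_moment /half_onemX exprZn -scalerAr poly_intZ mulrCA -poly_intZ.
rewrite (_ : _ *: (_ * _) = ((- 2 * (e + 7)%:R) *: (1 - 'X) ^+ (e + 6) +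
  (e + 6)%:R *: (1 - 'X) ^+ (e + 7))^`()); last first.
  have -> : (e + 6 = (5 + e).+1)%N by lia.
  have -> : (e + 7 = (5 + e).+2)%N by lia.
  rewrite /jacobi_weight !(derivD, derivZ, deriv_exp, derivN, derivX) -polyC1 derivC.
  rewrite -!mul_polyC !(polyCM, polyCN, polyC_natr) polyC1.
  by rewrite -pred_Sn [(1 - 'X) ^+ (5 + e).+1]exprS exprD; ring.
rewrite poly_int_deriv ?lerN1_1// !(hornerD, hornerZ, horner_exp, hornerN, hornerX).
rewrite -polyC1 !hornerC subrr opprK.
have z6 : 0 ^+ (e + 6) = 0 :> R by rewrite addnC expr0n.
have z7 : 0 ^+ (e + 7) = 0 :> R by rewrite addnC expr0n.
rewrite z6 z7 !exprD exprVn.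
have e2 : (2 : R) ^+ e != 0 by rewrite expf_neq0.
by rewrite !natrD; field; rewrite e2.
Qed.

(** By the first relation M a j (a + j + 6) (a + j + 7) does not depend on a; the
    other two then determine its dependence on j, two steps at a time. *)
Lemma polar_moments (M : nat -> nat -> R) :
  (forall a j, (a + j + 6)%:R * M a j = (a + j + 8)%:R * M a.+1 j) ->
  (forall a, M a 1%N = 0) ->
  (forall a j, (j + 7)%:R * M a j.+2 = (j + 1)%:R * M a.+2 j) ->
  exists C, forall a j, M a j = C * angular_moment j * radial_moment (a + j).
Proof.
move=> radial odd step.
have pos n k : (n + k.+1)%:R != 0 :> R by rewrite pnatr_eq0 addnS.
have nu0 e : radial_moment e != 0.
  by rewrite radial_momentE mulf_neq0// invr_eq0 mulf_neq0.
pose c j := M 0%N j / radial_moment j.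
have Mc a j : M a j = c j * radial_moment (a + j).
  elim: a => [|a IH]; first by rewrite add0n /c divfK.
  apply: (mulfI (pos (a + j)%N 7%N)); rewrite -radial IH !radial_momentE addSn.
  rewrite (_ : ((a + j).+1 + 6 = a + j + 7)%N); last by lia.
  rewrite (_ : ((a + j).+1 + 7 = a + j + 8)%N); last by lia.
  have := (pos (a + j)%N 5%N, pos (a + j)%N 6%N, pos (a + j)%N 7%N).
  move: ((a + j + 6)%:R : R) ((a + j + 7)%:R : R) ((a + j + 8)%:R : R) => x y z.
  by move=> [[x0 y0] z0]; field; rewrite x0 y0 z0.
have c1 : c 1%N = 0 by rewrite /c odd mul0r.
have cS j : (j + 7)%:R * c j.+2 = (j + 1)%:R * c j.
  apply: (mulIf (nu0 j.+2)); rewrite -[LHS]mulrA -[RHS]mulrA -[j.+2]add0n -Mc.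
  by rewrite step Mc !addSn !add0n.
have mu0 : angular_moment 0 != 0 by rewrite angular_moment0 mulf_neq0.
exists (c 0%N / angular_moment 0) => a j; rewrite Mc; congr (_ * _).
suff [] : c j = c 0%N / angular_moment 0 * angular_moment j /\
    c j.+1 = c 0%N / angular_moment 0 * angular_moment j.+1 by [].
elim: j => [|j [IH1 IH2]]; first by rewrite divfK// c1 angular_moment1 mulr0.
split=> //; apply: (mulfI (pos j 6%N)).
by rewrite cS IH1 mulrCA -angular_moment_rec mulrCA.
Qed.

End PolarMoments.

(** * Coordinates adapted to an edge *)

Section Polar.
Variables (R : realType) (T : triangle R) (i : 'I_3).

Local Notation poly2 := (mpoly.mpoly 2 R).
Implicit Types (p q : poly2) (u : R * R).

Definition dirder u p : poly2 :=
  u.1 *: mpoly.mderiv 0 p + u.2 *: mpoly.mderiv 1 p.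

Lemma dirderD u p q : dirder u (p + q) = dirder u p + dirder u q.
Proof. by rewrite /dirder !mpoly.mderivD !scalerDr addrACA. Qed.

Lemma dirderN u p : dirder u (- p) = - dirder u p.
Proof. by rewrite /dirder !mpoly.mderivN !scalerN opprD. Qed.

Lemma dirderM u p q : dirder u (p * q) = dirder u p * q + p * dirder u q.
Proof.
rewrite /dirder !mpoly.mderivM !scalerDr mulrDl mulrDr.
by rewrite -!scalerAl -!scalerAr addrACA.
Qed.

Lemma dirder1 u : dirder u 1 = 0.
Proof. by rewrite /dirder -mpoly.mpolyC1 !mpoly.mderivC !scaler0 addr0. Qed.

Lemma dirder_exp u p n : dirder u (p ^+ n.+1) = n.+1%:R * p ^+ n * dirder u p.
Proof.
elim: n => [|n IH]; first by rewrite expr0 !mul1r.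
by rewrite exprS dirderM IH -[n.+2%:R]natr1 exprS; ring.
Qed.

Lemma integral_dirder_bubble u p : tri_int T (dirder u (bubble_pol T * p)) = 0.
Proof.
by rewrite /dirder tri_intD !tri_intZ !integral_mderiv_bubble !mulr0 addr0.
Qed.

Local Notation ip := (iplus T i).
Local Notation im := (iminus T i).

Definition sum_pol : poly2 := bary_pol T ip + bary_pol T im.
Definition diff_pol : poly2 := bary_pol T ip - bary_pol T im.

(** From the vertex i to the midpoint of the opposite edge: s grows at unit rate
    while d is constant. *)
Definition sum_dir : R * R :=
  (((vertex T ip).1 + (vertex T im).1) / 2 - (vertex T i).1,
   ((vertex T ip).2 + (vertex T im).2) / 2 - (vertex T i).2).

(** Along half of the edge opposite to the vertex i: d grows at unit rate while s
    is constant. *)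
Definition diff_dir : R * R :=
  (((vertex T ip).1 - (vertex T im).1) / 2,
   ((vertex T ip).2 - (vertex T im).2) / 2).

Lemma dirder_bary_pol u j : dirder u (bary_pol T j) = const_pol
  ((u.1 * ((vertex T (j + 1)).2 - (vertex T (j + 2)).2) +
    u.2 * ((vertex T (j + 2)).1 - (vertex T (j + 1)).1)) /
   orient (vertex T 0) (vertex T 1) (vertex T 2)).
Proof.
rewrite /dirder !mderiv_bary_pol /= -!mpoly.mul_mpolyC /const_pol.
rewrite -!mpoly.mpolyCM -mpoly.mpolyCD; congr mpoly.mpolyC; ring.
Qed.

Lemma dirder_sum_sum : dirder sum_dir sum_pol = 1.
Proof.
rewrite dirderD !dirder_bary_pol /const_pol -mpoly.mpolyCD -mpoly.mpolyC1.
congr mpoly.mpolyC.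
have := vertex_noncollinear T; rewrite /sum_dir /iplus /iminus /orient.
by case: (ord3P i) => ->; case: (ccw T); rewrite !(add0r, ord3D) /= => D0; field.
Qed.

Lemma dirder_diff_sum : dirder sum_dir diff_pol = 0.
Proof.
rewrite dirderD dirderN !dirder_bary_pol /const_pol -mpoly.mpolyCN.
rewrite -mpoly.mpolyCD -(mpoly.mpolyC0 2 R).
congr mpoly.mpolyC.
have := vertex_noncollinear T; rewrite /sum_dir /iplus /iminus /orient.
by case: (ord3P i) => ->; case: (ccw T); rewrite !(add0r, ord3D) /= => D0; field.
Qed.

Lemma dirder_sum_diff : dirder diff_dir sum_pol = 0.
Proof.
rewrite dirderD !dirder_bary_pol /const_pol -mpoly.mpolyCD.
rewrite -(mpoly.mpolyC0 2 R); congr mpoly.mpolyC.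
have := vertex_noncollinear T; rewrite /diff_dir /iplus /iminus /orient.
by case: (ord3P i) => ->; case: (ccw T); rewrite !(add0r, ord3D) /= => D0; field.
Qed.

Lemma dirder_diff_diff : dirder diff_dir diff_pol = 1.
Proof.
rewrite dirderD dirderN !dirder_bary_pol /const_pol -mpoly.mpolyCN.
rewrite -mpoly.mpolyCD -mpoly.mpolyC1.
congr mpoly.mpolyC.
have := vertex_noncollinear T; rewrite /diff_dir /iplus /iminus /orient.
by case: (ord3P i) => ->; case: (ccw T); rewrite !(add0r, ord3D) /= => D0; field.
Qed.

End Polar.

(** * Moments of the weight *)

Section Weight.
Variables (R : realType) (T : triangle R) (i : 'I_3).

Local Notation poly2 := (mpoly.mpoly 2 R).
Local Notation ip := (iplus T i).
Local Notation im := (iminus T i).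
Local Notation s := (sum_pol T i).
Local Notation d := (diff_pol T i).
Implicit Types (p q : poly2) (x : R * R).

Lemma prod_ord3_from (V : comNzRingType) (F : 'I_3 -> V) :
  \prod_j F j = F i * F ip * F im.
Proof.
rewrite !big_ord_recl big_ord0 mulr1 /iplus /iminus.
rewrite (_ : lift ord0 ord0 = 1); last exact: val_inj.
rewrite (_ : lift ord0 _ = 2); last exact: val_inj.
by case: (ord3P i) => ->; case: (ccw T); rewrite ?(add0r, ord3D); ring.
Qed.

Lemma sum_ord3_from (V : comNzRingType) (F : 'I_3 -> V) :
  \sum_j F j = F i + F ip + F im.
Proof.
rewrite !big_ord_recl big_ord0 addr0 /iplus /iminus.
rewrite (_ : lift ord0 ord0 = 1); last exact: val_inj.
rewrite (_ : lift ord0 _ = 2); last exact: val_inj.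
by case: (ord3P i) => ->; case: (ccw T); rewrite ?(add0r, ord3D); ring.
Qed.

Lemma ord3_neq : (ip != i) * (im != i).
Proof.
rewrite /iplus /iminus.
by split; case: (ord3P i) => ->; case: (ccw T); rewrite ?(add0r, ord3D).
Qed.

Lemma bubble_quot_bary x : bubble_quot T i x = bary T ip x * bary T im x.
Proof.
rewrite /bubble_quot big_mkcond prod_ord3_from eqxx mul1r.
by rewrite !ord3_neq.
Qed.

(** Affine functions that agree at all points have the same coefficients, so
    linear relations between barycentric coordinates hold for polynomials. *)
Lemma sum_bary_pol (c : 'I_3 -> R) (c0 c1 c2 : R) :
  (forall x : R * R, \sum_j c j * bary T j x = c0 + c1 * x.1 + c2 * x.2) ->
  \sum_j c j *: bary_pol T j =
  const_pol c0 + const_pol c1 * coord_pol R 0 + const_pol c2 * coord_pol R 1.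
Proof.
move=> h.
pose D := orient (vertex T 0) (vertex T 1) (vertex T 2).
pose y j := vertex T (j + 1); pose z j := vertex T (j + 2).
pose A j := ((y j).1 * (z j).2 - (z j).1 * (y j).2) / D.
pose B j := ((y j).2 - (z j).2) / D; pose C j := ((z j).1 - (y j).1) / D.
have e x : \sum_j c j * A j + (\sum_j c j * B j) * x.1 +
    (\sum_j c j * C j) * x.2 = c0 + c1 * x.1 + c2 * x.2.
  rewrite -h !mulr_suml -!big_split /=; apply: eq_bigr => j _.
  by rewrite baryE /A /B /C /orient -/(y j) -/(z j) -/D; ring.
have e0 : \sum_j c j * A j = c0 by have := e (0, 0); rewrite /= !mulr0 !addr0.
have e1 : \sum_j c j * B j = c1.
  by have := e (1, 0); rewrite /= !mulr0 !mulr1 !addr0 e0 => /addrI.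
have e2 : \sum_j c j * C j = c2.
  by have := e (0, 1); rewrite /= !mulr0 !mulr1 !addr0 e0 => /addrI.
rewrite -e0 -e1 -e2 /const_pol !raddf_sum /= !mulr_suml -!big_split /=.
apply: eq_bigr => j _; rewrite /bary_pol -/D -/(y j) -/(z j) -/(A j) -/(B j) -/(C j).
by rewrite /const_pol !scalerDr -!mpoly.mul_mpolyC !mpoly.mpolyCM !mulrA.
Qed.

Lemma bary_pol_self : bary_pol T i = 1 - s.
Proof.
have : \sum_j 1 *: bary_pol T j = 1.
  rewrite (@sum_bary_pol (fun=> 1) 1 0 0) => [|x].
    by rewrite /const_pol mpoly.mpolyC1 mpoly.mpolyC0 !mul0r !addr0.
  by under eq_bigr do rewrite mul1r; rewrite sum_bary !mul0r !addr0.
by rewrite sum_ord3_from !scale1r /sum_pol => <-; ring.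
Qed.

Lemma bary_pol_plus : bary_pol T ip = 2^-1 *: (s + d).
Proof.
rewrite /sum_pol /diff_pol (_ : _ + _ = 2 *: bary_pol T ip); last first.
  by rewrite -mpoly.mul_mpolyC rmorph_nat; ring.
by rewrite scalerA mulVf ?scale1r.
Qed.

Lemma bary_pol_minus : bary_pol T im = 2^-1 *: (s - d).
Proof.
rewrite /sum_pol /diff_pol (_ : _ - _ = 2 *: bary_pol T im); last first.
  by rewrite -mpoly.mul_mpolyC rmorph_nat; ring.
by rewrite scalerA mulVf ?scale1r.
Qed.

(** Four times the bubble, see cone_bubbleE. *)
Definition cone_bubble : poly2 := (1 - s) * (s ^+ 2 - d ^+ 2).

(** Sixteen times the weight of the orthogonality relation, see
    peval_weight_pol. *)
Definition weight_pol : poly2 := (1 - s) * (s ^+ 2 - d ^+ 2) ^+ 2.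

Lemma cone_bubbleE : cone_bubble = 4 *: bubble_pol T.
Proof.
rewrite /bubble_pol prod_ord3_from bary_pol_self bary_pol_plus bary_pol_minus.
rewrite -!scalerAr -!scalerAl !scalerA (_ : 4 * _ * _ = 1); last by field.
by rewrite scale1r /cone_bubble; ring.
Qed.

Lemma peval_weight_pol x :
  peval weight_pol x = 16 * (bubble T x * bubble_quot T i x).
Proof.
rewrite bubble_quot_bary /bubble prod_ord3_from.
rewrite /weight_pol -bary_pol_self /sum_pol /diff_pol.
rewrite expr2 !(pevalM, pevalD, pevalN, peval_exp, peval_bary_pol). ring.
Qed.

Lemma integral_dirder_cone_bubble u p :
  tri_int T (dirder u (cone_bubble * p)) = 0.
Proof. by rewrite cone_bubbleE -scalerAl scalerAr integral_dirder_bubble. Qed.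

Lemma tri_int_mul_nat (n : nat) p : tri_int T (n%:R * p) = n%:R * tri_int T p.
Proof. by rewrite -(mpoly.mpolyC_nat) mpoly.mul_mpolyC tri_intZ. Qed.

Definition moment a j : R := tri_int T (weight_pol * (s ^+ a * d ^+ j)).

Lemma dirder_exp0 u p n : dirder u p = 0 -> dirder u (p ^+ n) = 0.
Proof. by case: n => [|n] h; rewrite ?expr0 ?dirder1// dirder_exp h mulr0. Qed.

Let dE := (dirderD, dirderN, dirderM, dirder_exp,
  fun n => dirder_exp0 n (dirder_diff_sum T i),
  fun n => dirder_exp0 n (dirder_sum_diff T i),
  dirder_sum_sum, dirder_sum_diff, dirder_diff_sum,
  dirder_diff_diff, dirder1).

(** The integral of the divergence of F (s, d) for F = w (1 - s) s^a d^j, whose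
    components are divisible by the bubble; the divergence is computed by
    Euler's relation for homogeneous polynomials. *)
Lemma moment_radial a j :
  (a + j + 6)%:R * moment a j = (a + j + 8)%:R * moment a.+1 j.
Proof.
pose g1 := (s ^+ 2 - d ^+ 2) * (1 - s) * (s ^+ a.+1 * d ^+ j).
pose g2 := (s ^+ 2 - d ^+ 2) * (1 - s) * (s ^+ a * d ^+ j.+1).
apply/eqP; rewrite -subr_eq0 /moment -!tri_int_mul_nat -mulN1r.
rewrite -tri_intZ -tri_intD.
rewrite (_ : _ + _ = dirder (sum_dir T i) (cone_bubble * g1) +
                     dirder (diff_dir T i) (cone_bubble * g2)).
  by rewrite tri_intD !integral_dirder_cone_bubble addr0.
rewrite scaleN1r /cone_bubble /g1 /g2 /weight_pol !dE !exprS.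
by rewrite !natrD -[j.+1%:R]natr1 -[a.+1%:R]natr1; ring.
Qed.

(** The d-derivative of w (s^2 - d^2) s^a integrates to zero. *)
Lemma moment_odd a : moment a 1%N = 0.
Proof.
pose g := (s ^+ 2 - d ^+ 2) ^+ 2 * s ^+ a.
suff : (- 6) * moment a 1%N = 0.
  by move/eqP; rewrite mulf_eq0 oppr_eq0 pnatr_eq0 => /eqP.
rewrite /moment mulNr -tri_int_mul_nat -mulN1r -tri_intZ.
rewrite (_ : _ *: _ = dirder (diff_dir T i) (cone_bubble * g)).
  exact: integral_dirder_cone_bubble.
rewrite scaleN1r /cone_bubble /g /weight_pol !dE !exprS.
by ring.
Qed.

(** The d-derivative of w (s^2 - d^2) s^a d^(j+1) integrates to zero. *)
Lemma moment_step a j : (j + 7)%:R * moment a j.+2 = (j + 1)%:R * moment a.+2 j.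
Proof.
pose g := (s ^+ 2 - d ^+ 2) ^+ 2 * (s ^+ a * d ^+ j.+1).
apply/eqP; rewrite eq_sym -subr_eq0 /moment -!tri_int_mul_nat.
rewrite -mulN1r -tri_intZ -tri_intD.
rewrite (_ : _ + _ = dirder (diff_dir T i) (cone_bubble * g)).
  by rewrite integral_dirder_cone_bubble.
rewrite scaleN1r /cone_bubble /g /weight_pol !dE !exprS.
by rewrite !natrD -[j.+1%:R]natr1; ring.
Qed.

Lemma momentE : exists C, forall a j,
  moment a j = C * angular_moment R j * radial_moment R (a + j).
Proof.
exact: polar_moments moment_radial moment_odd moment_step.
Qed.

End Weight.

(** * Linear spans *)

Section Span.
Variables (R : pzRingType) (V : lmodType R).
Implicit Types (S : set V) (u v : V).

Lemma lin_span0 S : lin_span S 0.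
Proof.
by exists 0%N, (fun=> 0), (fun=> 0); split=> [[]//|]; rewrite big_ord0.
Qed.

Lemma lin_spanD S u v : lin_span S u -> lin_span S v -> lin_span S (u + v).
Proof.
move=> [m [c [f [Sf ->]]]] [n [c' [f' [Sf' ->]]]].
exists (m + n)%N,
  (fun j => match fintype.split j with inl k => c k | inr k => c' k end),
  (fun j => match fintype.split j with inl k => f k | inr k => f' k end).
split=> [j|]; first by case: fintype.split.
rewrite big_split_ord /=; congr (_ + _); apply: eq_bigr => j _.
  by case: split_ordP => k /eqP; rewrite ?(eq_lshift, eq_lrshift)// => /eqP ->.
by case: split_ordP => k /eqP; rewrite ?(eq_rshift, eq_rlshift)// => /eqP ->.
Qed.

Lemma lin_spanZ S a u : lin_span S u -> lin_span S (a *: u).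
Proof.
move=> [m [c [f [Sf ->]]]]; exists m, (fun j => a * c j), f; split=> //.
by rewrite scaler_sumr; apply: eq_bigr => j _; rewrite scalerA.
Qed.

Lemma lin_span_mem S u : S u -> lin_span S u.
Proof.
move=> Su; exists 1%N, (fun=> 1), (fun=> u); split=> //.
by rewrite big_ord1 scale1r.
Qed.

Lemma lin_span_sum S (J : Type) (r : seq J) (P : pred J) (F : J -> V) :
  (forall j, P j -> lin_span S (F j)) -> lin_span S (\sum_(j <- r | P j) F j).
Proof.
move=> SF; elim/big_ind: _ => //; [exact: lin_span0|exact: lin_spanD].
Qed.

Lemma lin_span_ind S (P : V -> Prop) : P 0 ->
  (forall u v, P u -> P v -> P (u + v)) -> (forall a u, P u -> P (a *: u)) ->
  (forall u, S u -> P u) -> forall u, lin_span S u -> P u.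
Proof.
move=> P0 PD PZ PS u [n [c [f [Sf ->]]]].
by elim/big_ind: _ => // j _; exact/PZ/PS.
Qed.

Lemma lin_span_sub S S' : S `<=` lin_span S' -> lin_span S `<=` lin_span S'.
Proof.
move=> SS'; apply: lin_span_ind SS'; [exact: lin_span0|exact: lin_spanD|].
exact: lin_spanZ.
Qed.

End Span.

(** * Vanishing sums of one-dimensional moments *)

Section Factors.
Variable R : realType.
Implicit Types (j k n N : nat).

Definition radial_factor k n : {poly R} :=
  jacobi (k%:R *+ 2 + 2 + 2 + 1) 1 (n - k).
Definition angular_factor k : {poly R} := jacobi 2 2 k.
(** The radial factor as a polynomial in s, its argument being 1 - 2 s. *)
Definition radial_factor_sum k n : {poly R} :=
  radial_factor k n \Po (1 - 2 *: 'X).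

Lemma radial_factorE k n : radial_factor k n = jacobi (k.*2 + 5)%:R 1%:R (n - k).
Proof.
rewrite /radial_factor; congr jacobi.
by rewrite natrD -mul2n natrM -mulr_natl; ring.
Qed.

Lemma size_angular_factor k : size (angular_factor k) = k.+1.
Proof. exact: (size_jacobi R 2 2 k). Qed.

Lemma size_radial_factor k n : size (radial_factor k n) = (n - k).+1.
Proof. by rewrite radial_factorE size_jacobi. Qed.

Lemma size_radial_factor_sum k n : size (radial_factor_sum k n) = (n - k).+1.
Proof.
rewrite size_comp_poly2 ?size_radial_factor//.
rewrite addrC size_polyDl ?size_polyN ?size_scale ?size_polyX ?size_poly1//.
Qed.

Lemma half_onemX_comp : (1 - 2 *: 'X) \Po (half_onemX R) = 'X.
Proof.
rewrite comp_polyB comp_polyZ comp_polyX comp_polyC /half_onemX scalerA divff//.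
by rewrite scale1r opprB addrCA subrr addr0.
Qed.

(** The sum is the integral of (1 - u^2)^2 u^j times the angular factor, which is
    orthogonal to lower degrees. *)
Lemma sum_angular_moment0 k j : (j < k)%N ->
  \sum_(l < k.+1) (angular_factor k)`_l * angular_moment R (l + j) = 0.
Proof.
move=> jk.
transitivity (poly_int (-1) 1 (jacobi_weight R 2 2 * angular_factor k * 'X^j)).
  rewrite -[in RHS](coefK (angular_factor k)) size_angular_factor poly_def.
  rewrite mulr_sumr mulr_suml.
  rewrite (poly_int_sum _ _ _
    (fun l => jacobi_weight R 2 2 * ((angular_factor k)`_l *: 'X^l) * 'X^j)).
  apply: eq_bigr => l _.
  by rewrite -scalerAr -scalerAl poly_intZ /angular_moment exprD mulrA.
apply: (@jacobi_orthogonal R 2 2 k).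
by rewrite size_polyXn.
Qed.

(** The sum is, up to a constant, the integral of (1 - s) s^(N+5) times the
    radial factor. The weight of the latter takes 2 k of the N factors s, and
    the N - 2 k < n - k others form a polynomial of lower degree. *)
Lemma sum_radial_moment0 k n N : (k <= n)%N -> (k.*2 <= N)%N -> (N < n + k)%N ->
  \sum_(e < (n - k).+1) (radial_factor_sum k n)`_e * radial_moment R (e + N) = 0.
Proof.
move=> kn kN Nn.
transitivity (poly_int (-1) 1
  (jacobi_weight R 5 1 * half_onemX R ^+ N * radial_factor k n)).
  have -> : radial_factor k n = radial_factor_sum k n \Po half_onemX R.
    by rewrite -comp_polyA half_onemX_comp comp_polyXr.
  rewrite comp_polyE size_radial_factor_sum mulr_sumr.
  rewrite (poly_int_sum _ _ _ (fun e => jacobi_weight R 5 1 * half_onemX R ^+ N *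
    ((radial_factor_sum k n)`_e *: half_onemX R ^+ e))); apply: eq_bigr => e _.
  by rewrite -scalerAr poly_intZ -mulrA -exprD addnC /radial_moment.
have -> : jacobi_weight R 5 1 * half_onemX R ^+ N * radial_factor k n =
   (2^-1 ^+ k.*2) *: (jacobi_weight R (k.*2 + 5) 1 * radial_factor k n *
     half_onemX R ^+ (N - k.*2)).
  rewrite -[in LHS](subnK kN) [_ ^+ (_ + k.*2)]exprD.
  rewrite [half_onemX R ^+ k.*2]exprZn /jacobi_weight [_ ^+ (k.*2 + 5)]exprD.
  by rewrite -!mul_polyC; ring.
rewrite poly_intZ radial_factorE jacobi_orthogonal ?mulr0//.
rewrite (leq_trans (size_poly_exp_leq _ _))//.
rewrite size_scale ?size_onemX ?mul1n//.
by clear -kN Nn; lia.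
Qed.

End Factors.

(** * The Jacobi polynomials of the triangle *)

Section TrianglePolynomials.
Variables (R : realType) (T : triangle R) (i : 'I_3).

Local Notation poly2 := (mpoly.mpoly 2 R).
Local Notation ip := (iplus T i).
Local Notation im := (iminus T i).
Local Notation s := (sum_pol T i).
Local Notation d := (diff_pol T i).
Local Notation msize p := (mpoly.msize p).
Implicit Types (p q : poly2) (x : R * R) (k n m : nat).

(** The angular factor is homogenized to degree k, which absorbs the factor s^k
    and leaves no division by s. *)
Definition tri_jacobi_pol k n : poly2 :=
  (\sum_(l < k.+1) (angular_factor R k)`_l *: (s ^+ (k - l) * d ^+ l)) *
  (\sum_(e < (n - k).+1) (radial_factor_sum R k n)`_e *: s ^+ e).

Lemma tri_jacobi_polE k n : tri_jacobi_pol k n =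
  \sum_(l < k.+1) \sum_(e < (n - k).+1)
    ((angular_factor R k)`_l * (radial_factor_sum R k n)`_e) *:
    (s ^+ (e + (k - l)) * d ^+ l).
Proof.
rewrite /tri_jacobi_pol big_distrlr /=.
apply: eq_bigr => l _; apply: eq_bigr => e _.
by rewrite -scalerAl -scalerAr scalerA exprD; congr (_ *: _); ring.
Qed.

Lemma tri_int_sum (J : Type) (r : seq J) (F : J -> poly2) :
  tri_int T (\sum_(j <- r) F j) = \sum_(j <- r) tri_int T (F j).
Proof.
elim: r => [|j r IH]; last by rewrite !big_cons tri_intD IH.
by rewrite !big_nil -(scale0r (0 : poly2)) tri_intZ mul0r.
Qed.

(** Since the moments are products, the double sum over the coefficients of the
    two factors is a product of two sums, and one of them vanishes. *)
Lemma tri_jacobi_pol_orthogonal_monomial k n m j :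
  (k <= n)%N -> (m + j < n)%N ->
  tri_int T (weight_pol T i * tri_jacobi_pol k n * (s ^+ m * d ^+ j)) = 0.
Proof.
move=> kn mj; have [C MC] := momentE T i.
transitivity (C *
  (\sum_(l < k.+1) (angular_factor R k)`_l * angular_moment R (l + j)) *
  (\sum_(e < (n - k).+1)
     (radial_factor_sum R k n)`_e * radial_moment R (e + (k + m + j)))).
  rewrite tri_jacobi_polE mulr_sumr mulr_suml tri_int_sum -mulrA big_distrlr.
  rewrite mulr_sumr /=.
  apply: eq_bigr => l _; rewrite mulr_sumr mulr_suml tri_int_sum mulr_sumr.
  apply: eq_bigr => e _; rewrite -scalerAr -scalerAl tri_intZ.
  rewrite (_ : weight_pol T i * _ * _ =
    weight_pol T i * (s ^+ (e + (k - l) + m) * d ^+ (l + j))); last first.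
    by rewrite !exprD; ring.
  rewrite -/(moment T i _ _) MC.
  rewrite (_ : (e + (k - l) + m + (l + j) = e + (k + m + j))%N); first by ring.
  by have := ltn_ord l; lia.
case: (ltnP j k) => jk; first by rewrite sum_angular_moment0// mulr0 mul0r.
by rewrite sum_radial_moment0 ?mulr0//; lia.
Qed.

Lemma peval_tri_jacobi_pol k n x : tri T x -> peval (tri_jacobi_pol k n) x =
  tri_jacobi 1 2 2 k n (bary T i x) (bary T ip x) (bary T im x).
Proof.
rewrite triE => Tx; rewrite /tri_jacobi_pol /tri_jacobi pevalM.
set a := bary T i x; set b := bary T ip x; set c := bary T im x.
have abc : a + b + c = 1 by rewrite -(sum_bary T x) (sum_ord3_from T i).
have es : peval s x = b + c by rewrite pevalD !peval_bary_pol.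
have ed : peval d x = b - c by rewrite pevalD pevalN !peval_bary_pol.
have -> : peval (\sum_(e < (n - k).+1) (radial_factor_sum R k n)`_e *: s ^+ e) x =
    (radial_factor R k n).[a - b - c].
  have -> : a - b - c = (1 - 2 *: 'X).[b + c].
    by rewrite !hornerE; lra.
  rewrite -horner_comp horner_coef size_radial_factor_sum peval_sum.
  by apply: eq_bigr => e _; rewrite pevalZ peval_exp es.
rewrite [RHS]mulrAC -/(angular_factor R k); congr (_ * _).
have -> : peval (\sum_(l < k.+1)
      (angular_factor R k)`_l *: (s ^+ (k - l) * d ^+ l)) x =
    \sum_(l < k.+1)
      (angular_factor R k)`_l * ((b + c) ^+ (k - l) * (b - c) ^+ l).
  rewrite peval_sum; apply: eq_bigr => l _.
  by rewrite pevalZ pevalM !peval_exp es ed.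
rewrite horner_coef size_angular_factor mulr_sumr; apply: eq_bigr => l _.
rewrite [RHS]mulrCA; congr (_ * _).
have lk : (l <= k)%N by rewrite -ltnS.
move: (nat_of_ord l) lk => {}l lk.
(* At the vertex where s = 0 both sides are 1 if k = 0, and 0 if k > 0, whatever
   the value of the quotient d / s. *)
have [bc0|bc0] := eqVneq (b + c) 0; last first.
  rewrite -[in RHS](subnK lk) exprD expr_div_n -mulrA [_ ^+ l * (_ / _)]mulrCA.
  by rewrite divff ?mulr1// expf_neq0.
have /andP[/eqP b0 /eqP c0] : (b == 0) && (c == 0).
  by rewrite -paddr_eq0 ?Tx// bc0.
rewrite b0 c0 subrr addr0 invr0 mulr0 -exprD subnK//.
case: l lk => [|l] lk; first by rewrite mulr1.
by rewrite [0 ^+ l.+1]expr0n mulr0 expr0n gtn_eqF// (leq_trans _ lk).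
Qed.

Lemma msize_mul p q m n : (msize p <= m.+1)%N -> (msize q <= n.+1)%N ->
  (msize (p * q) <= (m + n).+1)%N.
Proof.
move=> pm qn; have [->|p0] := eqVneq p 0; first by rewrite mul0r mpoly.msize0.
have [->|q0] := eqVneq q 0; first by rewrite mulr0 mpoly.msize0.
rewrite mpoly.msizeM//.
by move: (msize p) (msize q) pm qn => a b; lia.
Qed.

Lemma msize_lin_span (S : set poly2) n :
  (forall p, S p -> (msize p <= n)%N) ->
  forall p, lin_span S p -> (msize p <= n)%N.
Proof.
move=> Sn; apply: lin_span_ind => // [|p q pn qn|a p pn].
- by rewrite mpoly.msize0.
- by apply: leq_trans (mpoly.msizeD_le _ _) _; rewrite geq_max pn qn.
- exact: leq_trans (mpoly.msizeZ_le _ _) pn.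
Qed.

Lemma msize_bary_pol j : (msize (bary_pol T j) <= 2)%N.
Proof.
apply: (@msize_lin_span [set p | (msize p <= 2)%N]) => //.
have X2 c (k : 'I_2) : (msize (const_pol c * coord_pol R k) <= 2)%N.
  apply: (@msize_mul _ _ 0%N 1%N); first by rewrite mpoly.msizeC leq_b1.
  by rewrite mpoly.msizeX mpoly.mdeg1.
rewrite /bary_pol /=; do 2?[apply: lin_spanD]; apply: lin_span_mem => //=.
by rewrite mpoly.msizeC; case: eqP.
Qed.

Lemma msize_sd a j : (msize (s ^+ a * d ^+ j) <= (a + j).+1)%N.
Proof.
have ex p n : (msize p <= 2)%N -> (msize (p ^+ n) <= n.+1)%N.
  move=> p2; elim: n => [|n IH]; first by rewrite expr0 mpoly.msize1.
  by rewrite exprS; exact: (@msize_mul _ _ 1%N n).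
apply: msize_mul; apply: ex.
  apply: leq_trans (mpoly.msizeD_le _ _) _.
  by rewrite geq_max !msize_bary_pol.
apply: leq_trans (mpoly.msizeD_le _ _) _.
by rewrite mpoly.msizeN geq_max !msize_bary_pol.
Qed.

Definition sd_monomials n : set poly2 :=
  [set s ^+ aj.1 * d ^+ aj.2 |
    aj in [set aj : nat * nat | (aj.1 + aj.2 <= n)%N]].

Lemma sd_monomialsP n a j : (a + j <= n)%N -> sd_monomials n (s ^+ a * d ^+ j).
Proof. by move=> ajn; exists (a, j). Qed.

Lemma coord_pol_sd (k : 'I_2) : exists c0 c1 c2 : R,
  coord_pol R k = c0 *: 1 + c1 *: s + c2 *: d.
Proof.
have k1 : k != 0 -> k = 1 by case: k => [[|[|]]]// *; exact: val_inj.
pose c j := if k == 0 then (vertex T j).1 else (vertex T j).2.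
have -> : coord_pol R k = \sum_j c j *: bary_pol T j.
  rewrite (@sum_bary_pol R T c 0 (k == 0)%:R (k != 0)%:R) => [|x].
    rewrite /const_pol mpoly.mpolyC0 add0r.
    have [->|k0] := eqVneq k 0; rewrite mpoly.mpolyC0 mpoly.mpolyC1 mul1r mul0r.
      by rewrite addr0.
    by rewrite add0r k1.
  have [e1 e2] := bary_coord T x.
  rewrite /c; case: (k == 0); rewrite !(mul0r, mul1r, add0r, addr0)
    ?[in RHS]e1 ?[in RHS]e2; by apply: eq_bigr => j _; rewrite mulrC.
rewrite (sum_ord3_from T i) bary_pol_self bary_pol_plus bary_pol_minus !scalerA.
exists (c i), ((c ip + c im) / 2 - c i), ((c ip - c im) / 2).
rewrite -!mpoly.mul_mpolyC !(mpoly.mpolyCM, mpoly.mpolyCD, mpoly.mpolyCN).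
by ring.
Qed.

(** The coordinates are affine functions of s and d, so the passage from one pair
    to the other preserves degrees. *)
Lemma sd_span n p : (msize p <= n.+1)%N -> lin_span (sd_monomials n) p.
Proof.
pose V n := lin_span (sd_monomials n).
have VS m q : V m q -> V m.+1 q /\ V m.+1 (s * q) /\ V m.+1 (d * q).
  move=> Vq; split; first by apply: lin_span_sub Vq => _ [[a j] /= h <-];
    apply/lin_span_mem/sd_monomialsP; lia.
  elim/lin_span_ind: q / Vq
    => [|q q' [h1 h2] [h3 h4]|c q [h1 h2]|_ [[a j] /= h <-]].
  - by rewrite !mulr0; split; exact: lin_span0.
  - by rewrite !mulrDr; split; exact: lin_spanD.
  - by rewrite -!scalerAr; split; exact: lin_spanZ.
  - rewrite mulrA -exprS mulrCA -exprS.
    by split; apply/lin_span_mem/sd_monomialsP; lia.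
have VX (k : 'I_2) m q : V m q -> V m.+1 (coord_pol R k * q).
  move=> /VS[h0 [h1 h2]]; have [c0 [c1 [c2 ->]]] := coord_pol_sd k.
  rewrite !mulrDl -!scalerAl mul1r.
  by do 2?[apply: lin_spanD]; exact: lin_spanZ.
have V1 : V 0%N 1.
  by apply: lin_span_mem; rewrite -[1]mulr1 -{1}(expr0 s) -(expr0 d);
    exact: sd_monomialsP.
have Vmono m m' q : (m <= m')%N -> V m q -> V m' q.
  move=> mm' Vq; rewrite -(subnK mm').
  by elim: (m' - m)%N => [//|t IH]; rewrite addSn; have [] := VS _ _ IH.
have VXX a b : V (a + b)%N (coord_pol R 0 ^+ a * coord_pol R 1 ^+ b).
  elim: a => [|a IH]; last by rewrite exprS -mulrA addSn; exact: VX.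
  rewrite expr0 mul1r add0n; elim: b => [|b IH]; first by rewrite expr0.
  by rewrite exprS; exact: VX.
move=> pn; rewrite [p]mpoly.mpolyE big_seq; apply: lin_span_sum => m mp.
apply: lin_spanZ; rewrite mpoly.mpolyXE_id.
have := leq_trans (mpoly.msize_mdeg_lt mp) pn; rewrite mpoly.mdegE.
rewrite !big_ord_recl !big_ord0 mulr1 addn0.
rewrite (_ : lift _ _ = 1); last exact: val_inj.
by rewrite ltnS => /Vmono; apply; exact: VXX.
Qed.

Lemma tri_jacobi_pol_orthogonal k n p : (k <= n)%N -> (msize p <= n)%N ->
  tri_int T (weight_pol T i * tri_jacobi_pol k n * p) = 0.
Proof.
move=> kn; case: n kn => [|n] kn pn.
  have -> : p = 0 by apply/eqP; rewrite -mpoly.msize_poly_eq0 -leqn0.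
  by rewrite mulr0 -(scale0r (0 : poly2)) tri_intZ mul0r.
move/sd_span: pn.
elim/lin_span_ind: p / => [|p q hp hq|c p hp|_ [[a j] /= h <-]].
- by rewrite mulr0 -(scale0r (0 : poly2)) tri_intZ mul0r.
- by rewrite mulrDr tri_intD hp hq addr0.
- by rewrite -scalerAr tri_intZ hp mulr0.
- exact: tri_jacobi_pol_orthogonal_monomial.
Qed.

Lemma msize_tri_jacobi_pol k n : (k <= n)%N ->
  (msize (tri_jacobi_pol k n) <= n.+1)%N.
Proof.
move=> kn; apply: (@msize_lin_span (sd_monomials n)) => [_ [[a j] /= h <-]|].
  exact: leq_trans (msize_sd _ _) _.
rewrite tri_jacobi_polE; apply: lin_span_sum => l _; apply: lin_span_sum => e _.
apply/lin_spanZ/lin_span_mem/sd_monomialsP.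
by have := (ltn_ord l, ltn_ord e) => -[]; lia.
Qed.

(** Modulo lower degree the family is triangular in the monomials s^(n-j) d^j,
    ordered by the exponent of d, with leading coefficients on the diagonal. *)
Lemma tri_jacobi_pol_span_mod n p : (msize p <= n.+1)%N -> exists p1 p2,
  [/\ p = p1 + p2,
      lin_span [set tri_jacobi_pol k n | k in [set k | (k <= n)%N]] p1 &
      (msize p2 <= n)%N].
Proof.
set Q := [set tri_jacobi_pol k n | k in _].
pose U := lin_span (Q `|` [set p | (msize p <= n)%N]).
move=> /sd_span pn.
have {pn} : U p.
  apply: lin_span_sub pn => _ [[a j] /= + <-].
  elim/ltn_ind: j a => j IH a.
  rewrite leq_eqVlt => /predU1P[ajn|ajn]; last first.
    by apply: lin_span_mem; right => /=; exact: leq_trans (msize_sd _ _) ajn.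
  have jn : (j <= n)%N by rewrite -ajn leq_addl.
  have aE : a = (n - j)%N by rewrite -ajn addnK.
  (* The diagonal coefficient. *)
  pose kappa := (angular_factor R j)`_j * (radial_factor_sum R j n)`_(n - j).
  have kappa0 : kappa != 0.
    have h1 : lead_coef (angular_factor R j) = (angular_factor R j)`_j.
      by rewrite lead_coefE size_angular_factor.
    have h2 : lead_coef (radial_factor_sum R j n) =
        (radial_factor_sum R j n)`_(n - j).
      by rewrite lead_coefE size_radial_factor_sum.
    by rewrite /kappa -h1 -h2 mulf_neq0// lead_coef_eq0 -size_poly_gt0
      ?size_angular_factor ?size_radial_factor_sum.
  have Uj : U (tri_jacobi_pol j n) by apply: lin_span_mem; left; exists j.
  have Ulow e l : (e < a)%N -> (l <= j)%N -> U (s ^+ (e + (j - l)) * d ^+ l).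
    move=> he hl; apply: lin_span_mem; right => /=.
    by apply: leq_trans (msize_sd _ _) _; lia.
  move: Uj; rewrite tri_jacobi_polE big_ord_recr /= big_ord_recr /= addrA.
  rewrite subnn addn0 -aE.
  (* X collects the terms that are of lower degree or have a smaller power of d. *)
  set X := (X in U (X + _)) => UX.
  have UX' : U X.
    apply: lin_spanD; last first.
      apply: lin_span_sum => e _; apply: lin_spanZ.
      by rewrite -[X in s ^+ (e + X)](subnn j); apply: Ulow.
    apply: lin_span_sum => l _; rewrite big_ord_recr /=.
    apply: lin_spanD.
      by apply: lin_span_sum => e _; apply/lin_spanZ/Ulow => //; exact: ltnW.
    apply: lin_spanZ; apply: IH => //.
    by have := ltn_ord l; lia.
  have -> : s ^+ a * d ^+ j =
      kappa^-1 *: ((X + kappa *: (s ^+ a * d ^+ j)) + (-1) *: X).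
    by rewrite scaleN1r addrC addKr scalerA mulVf// scale1r.
  apply/lin_spanZ/lin_spanD; last exact: lin_spanZ.
  by move: UX; rewrite /kappa -aE.
elim/lin_span_ind: p /
  => [|p q [p1 [p2 [-> h1 h2]]] [q1 [q2 [-> h3 h4]]]
     |c p [p1 [p2 [-> h1 h2]]]|p [Qp|pn]].
- by exists 0, 0; split; rewrite ?addr0 ?mpoly.msize0//; exact: lin_span0.
- exists (p1 + q1), (p2 + q2); split; [by rewrite addrACA|exact: lin_spanD|].
  by apply: leq_trans (mpoly.msizeD_le _ _) _; rewrite geq_max h2.
- exists (c *: p1), (c *: p2); split; [by rewrite scalerDr|exact: lin_spanZ|].
  exact: leq_trans (mpoly.msizeZ_le _ _) h2.
- exists p, 0; split; rewrite ?addr0 ?mpoly.msize0//; exact: lin_span_mem.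
- by exists 0, p; split; rewrite ?add0r//; exact: lin_span0.
Qed.

End TrianglePolynomials.

(** * The orthogonality relation of the space *)

Section Qspace.
Variables (R : realType) (T : triangle R) (i : 'I_3).

Local Notation poly2 := (mpoly.mpoly 2 R).
Implicit Types (p q : poly2) (v : tri T -> R).

Definition on_tri p : tri T -> R := fun x => peval p (set_val x).

Lemma Pspace_on_tri n v : Pspace T (n%:Z - 1) v <->
  exists2 p, (mpoly.msize p <= n)%N & v = on_tri p.
Proof.
split=> [[p pn vp]|[p pn ->]]; exists p => //.
- by move: pn; rewrite subrK lez_nat.
- exact/funext.
- by rewrite subrK lez_nat.
Qed.

Lemma tri_integral_weight p q :
  tri_integral (fun x : tri T => bubble T (set_val x) *
    bubble_quot T i (set_val x) * on_tri p x * on_tri q x) =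
  (16^-1 * tri_int T (weight_pol T i * p * q))%:E.
Proof.
rewrite -tri_intZ; apply: tri_integralE => x; rewrite /on_tri.
by rewrite pevalZ 2!pevalM peval_weight_pol; field.
Qed.

Lemma weight_definite p :
  tri_int T (weight_pol T i * p * p) = 0 -> on_tri p = cst 0.
Proof.
move=> /tri_int_definite p0; apply/funext => x; apply: p0 => [y|y|].
- rewrite triE => y0; rewrite peval_weight_pol mulr_ge0// bubble_quot_bary.
  by rewrite mulr_ge0 ?prodr_ge0// mulr_ge0 ?y0.
- move=> y0; rewrite peval_weight_pol mulr_gt0// bubble_quot_bary.
  by rewrite mulr_gt0 ?prodr_gt0// mulr_gt0 ?y0.
- exact: set_valP.
Qed.

Lemma jacobi_on_pol k n :
  jacobi_on T i 1 2 2 k n = on_tri (tri_jacobi_pol T i k n).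
Proof.
by apply/funext => x; rewrite /on_tri peval_tri_jacobi_pol//; exact: set_valP.
Qed.

Lemma jacobi_span n v :
  lin_span [set jacobi_on T i 1 2 2 k n | k in [set k | (k <= n)%N]] v <->
  exists2 p,
    lin_span [set tri_jacobi_pol T i k n | k in [set k | (k <= n)%N]] p &
    v = on_tri p.
Proof.
split.
  move: v; apply: lin_span_ind
    => [|u v [p hp ->] [q hq ->]|a u [p hp ->]|v [k kn <-]].
  - by exists 0; [exact: lin_span0|apply/funext => x; rewrite /on_tri peval0].
  - exists (p + q); first exact: lin_spanD.
    by apply/funext => x; rewrite /on_tri pevalD.
  - exists (a *: p); first exact: lin_spanZ.
    by apply/funext => x; rewrite /on_tri pevalZ.
  - exists (tri_jacobi_pol T i k n); last exact: jacobi_on_pol.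
    by apply: lin_span_mem; exists k.
move=> [p + ->]; move: p; apply: lin_span_ind => [|p q hp hq|a p hp|p [k kn <-]].
- rewrite (_ : on_tri 0 = 0); first exact: lin_span0.
  by apply/funext => x; rewrite /on_tri peval0.
- rewrite (_ : on_tri _ = on_tri p + on_tri q); first exact: lin_spanD.
  by apply/funext => x; rewrite /on_tri pevalD.
- rewrite (_ : on_tri _ = a *: on_tri p); first exact: lin_spanZ.
  by apply/funext => x; rewrite /on_tri pevalZ.
- by rewrite -jacobi_on_pol; apply: lin_span_mem; exists k.
Qed.

Lemma tri_jacobi_span_orthogonal n p q : (mpoly.msize q <= n)%N ->
  lin_span [set tri_jacobi_pol T i k n | k in [set k | (k <= n)%N]] p ->
  tri_int T (weight_pol T i * p * q) = 0.
Proof.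
move=> qn; move: p; apply: lin_span_ind => [|p p' hp hp'|a p hp|p [k kn <-]].
- by rewrite mulr0 mul0r -(scale0r (0 : poly2)) tri_intZ mul0r.
- by rewrite mulrDr mulrDl tri_intD hp hp' addr0.
- by rewrite -scalerAr -scalerAl tri_intZ hp mulr0.
- exact: tri_jacobi_pol_orthogonal.
Qed.

End Qspace.

Theorem lemma3p4 (R : realType) (r : nat) (r_ge2 : (2 <= r)%N)
    (T : triangle R) (i : 'I_3) :
  Qspace T i r =
  lin_span [set jacobi_on T i 1 2 2 k (r - 2) | k in [set k | (k <= r - 2)%N]].
Proof.
set n := (r - 2)%N.
have r2 : r%:Z - 2 = n.+1%:Z - 1 by rewrite /n; lia.
have r3 : r%:Z - 3 = n%:Z - 1 by rewrite /n; lia.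
apply/seteqP; split=> v; rewrite /Qspace /= r2 r3.
  move=> [/Pspace_on_tri[p pn ->] ortho]; apply/jacobi_span.
  have [p1 [p2 [pE p1S p2n]]] := tri_jacobi_pol_span_mod T i pn.
  exists p1 => //; suff p20 : on_tri p2 = cst 0 :> (tri T -> R).
    apply/funext => x; rewrite /on_tri pE pevalD.
    by rewrite -[peval p2 _]/(on_tri p2 x) p20 addr0.
  apply: (@weight_definite _ _ i).
  have /ortho : Pspace T (n%:Z - 1) (on_tri p2).
    by apply/Pspace_on_tri; exists p2.
  rewrite tri_integral_weight pE mulrDr mulrDl tri_intD.
  rewrite (tri_jacobi_span_orthogonal p2n p1S) add0r => -[] /eqP.
  by rewrite mulf_eq0 invr_eq0 pnatr_eq0 => /eqP.
move=> /jacobi_span[p pS ->]; split.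
  apply/Pspace_on_tri; exists p => //; apply: msize_lin_span pS => _ [k kn <-].
  exact: msize_tri_jacobi_pol.
move=> q /Pspace_on_tri[{}q qn ->].
by rewrite tri_integral_weight (tri_jacobi_span_orthogonal qn pS) mulr0.
Qed.
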